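(* Let $n\ge1$ and let $X=\{z\in\mathbb{C}^{n+1}\setminus\{0\}: z_1^2+\cdots+z_{n+1}^2=0\}$ be the Kepler manifold, with the Kähler metric $g$ whose associated Kähler form is $\omega=\frac i2\partial\bar\partial|x|$, where $x=\operatorname{Im}z$ (so $|x|=\sqrt{z\cdot\bar z/2}$ on $X$). Then $g$ is not projectively induced.
   Context: A Kähler metric $g$ on a complex manifold $M$ is projectively induced if there exist $N\le\infty$ and a holomorphic immersion $\psi:M\to\mathbb{C}P^N$ with $\psi^*(g_{FS})=g$. Here $\mathbb{C}P^\infty$ is the projective space of the Hilbert space $\ell^2(\mathbb{C})$, and $g_{FS}$ is the Fubini–Study metric, whose Kähler form in homogeneous coordinates is $\omega_{FS}=\frac i2\partial\bar\partial\log\sum_j|Z_j|^2$. *)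

(* Defs.v *)
From HB Require Import structures.
From mathcomp Require Import all_boot all_order all_algebra.
From mathcomp Require Import complex.
From mathcomp Require Import all_classical all_reals all_analysis.
From mathcomp Require Import ring.

Set Implicit Arguments.
Unset Strict Implicit.
Unset Printing Implicit Defensive.

Import Order.TTheory GRing.Theory Num.Theory numFieldNormedType.Exports.

Local Open Scope classical_set_scope.
Local Open Scope ring_scope.
Local Open Scope complex_scope.

(* [R[i]] is a [numFieldType], but the topology that such types carry is only
   found through coercions; this registers it on the head constant [complex]. *)
HB.instance Definition _ (R : rcfType) := NormedModule.copy R[i] R[i]^o.

Definition sqnormc {R : rcfType} (z : R[i]) : R :=
  complex.Re z ^+ 2 + complex.Im z ^+ 2.

Lemma sqnormc_ge0 (R : rcfType) (z : R[i]) : 0 <= sqnormc z.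
Proof. by rewrite addr_ge0 ?sqr_ge0. Qed.

Lemma sqnormcM (R : rcfType) (a z : R[i]) :
  sqnormc (a * z) = sqnormc a * sqnormc z.
Proof. by case: a => a b; case: z => x y; rewrite /sqnormc /=; ring. Qed.

Lemma sqnormc_eq0 (R : rcfType) (z : R[i]) : (sqnormc z == 0) = (z == 0).
Proof.
by case: z => x y; rewrite /sqnormc /= paddr_eq0 ?sqr_ge0// !sqrf_eq0 eq_complex.
Qed.

Lemma normcE_sqnormc (R : rcfType) (z : R[i]) :
  `|z| = (Num.sqrt (sqnormc z))%:C.
Proof. by case: z => x y. Qed.

Lemma sqnormcD_le (R : rcfType) (s t : R) (a b : R[i]) : 0 < s -> 0 < t ->
  sqnormc (a + b) <= (1 + t / s) * sqnormc a + (1 + s / t) * sqnormc b.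
Proof.
move=> s0 t0; case: a => x y; case: b => z w; rewrite /sqnormc /=.
rewrite -subr_ge0.
have -> : (1 + t / s) * (x ^+ 2 + y ^+ 2) + (1 + s / t) * (z ^+ 2 + w ^+ 2) -
          ((x + z) ^+ 2 + (y + w) ^+ 2) =
          ((t * x - s * z) ^+ 2 + (t * y - s * w) ^+ 2) / (s * t).
  by field; rewrite !gt_eqF.
by rewrite divr_ge0 ?addr_ge0 ?sqr_ge0 ?mulr_ge0 // ltW.
Qed.

Section ell2.
Variables (R : realType) (I : choiceType).

Definition ell2_sum (f : I -> R[i]) : \bar R :=
  \esum_(j in [set: I]) (sqnormc (f j))%:E.

Definition square_summable : {pred (I -> R[i])} :=
  [pred f | (ell2_sum f < +oo)%E].

Record ell2 := Ell2 {
  ell2_fun :> I -> R[i];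
  ell2_funP : ell2_fun \in square_summable }.

HB.instance Definition _ := [isSub for ell2_fun].
HB.instance Definition _ := [Choice of ell2 by <:].

Lemma ell2_sum_ge0 f : (0 <= ell2_sum f)%E.
Proof. by apply: esum_ge0 => j _; rewrite lee_fin sqnormc_ge0. Qed.

Lemma esumZ (c : R) (a : I -> \bar R) : 0 <= c -> (forall j, 0 <= a j)%E ->
  (\esum_(j in [set: I]) (c%:E * a j) = c%:E * \esum_(j in [set: I]) a j)%E.
Proof.
move=> c0 a0; rewrite /esum -ereal_supZl//; last first.
  by apply/set0P; exists (\sum_(x \in set0) a x)%E; exists set0 => //; exact: fsets_set0.
congr ereal_sup; apply/seteqP; split => [_ [A [finA AT]] <-|].
  exists (\sum_(x \in A) a x)%E; first by exists A.
  by rewrite ge0_mule_fsumr.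
move=> _ [_ [A FA <-] <-]; exists A => //.
by rewrite ge0_mule_fsumr.
Qed.

Lemma ell2_sumD_le (s t : R) (f g : I -> R[i]) : 0 < s -> 0 < t ->
  (ell2_sum (f + g)%R <=
   (1 + t / s)%:E * ell2_sum f + (1 + s / t)%:E * ell2_sum g)%E.
Proof.
move=> s0 t0; have ts : 0 <= 1 + t / s by rewrite addr_ge0// divr_ge0// ltW.
have st : 0 <= 1 + s / t by rewrite addr_ge0// divr_ge0// ltW.
rewrite /ell2_sum -!esumZ// => [|j|j]; rewrite ?lee_fin ?sqnormc_ge0//.
rewrite -esumD => [|j _|j _]; rewrite ?lee_fin ?mulr_ge0 ?sqnormc_ge0//.
by apply: le_esum => j _; rewrite lee_fin; exact: sqnormcD_le.
Qed.

Lemma ell2_sumZ (a : R[i]) (f : I -> R[i]) : ell2_sum (a *: f) = ((sqnormc a)%:E * ell2_sum f)%E.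
Proof.
rewrite /ell2_sum -esumZ ?sqnormc_ge0// => [|j]; last first.
  by rewrite lee_fin sqnormc_ge0.
by apply: eq_esum => j _; rewrite -EFinM -sqnormcM.
Qed.

Lemma square_summable_submod : GRing.submod_closed square_summable.
Proof.
split=> [|a f g]; rewrite !inE /=.
  rewrite /ell2_sum esum1 ?ltry// => j _.
  by congr EFin; apply/eqP; rewrite sqnormc_eq0.
move=> foo goo; apply: le_lt_trans (ell2_sumD_le _ _ ltr01 ltr01) _.
rewrite lte_add_pinfty//; apply: lte_mul_pinfty => //;
  rewrite ?lee_fin ?addr_ge0 ?divr_ge0//.
by rewrite ell2_sumZ lte_mul_pinfty// lee_fin sqnormc_ge0.
Qed.

HB.instance Definition _ :=
  GRing.isSubmodClosed.Build R[i] (I -> R[i]) square_summable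
    square_summable_submod.
HB.instance Definition _ := [SubChoice_isSubLmodule of ell2 by <:].

Definition ell2_sqnorm (Z : ell2) : R := fine (ell2_sum Z).

Definition ell2_norm (Z : ell2) : R[i] := (Num.sqrt (ell2_sqnorm Z))%:C.

Lemma ell2_sqnormE Z : (ell2_sqnorm Z)%:E = ell2_sum Z.
Proof.
by rewrite fineK// ge0_fin_numE ?ell2_sum_ge0//; have := ell2_funP Z; rewrite inE.
Qed.

Lemma ell2_sqnorm_ge0 Z : 0 <= ell2_sqnorm Z.
Proof. by rewrite -lee_fin ell2_sqnormE ell2_sum_ge0. Qed.

Lemma ell2_norm0_eq0 Z : ell2_norm Z = 0 -> Z = 0.
Proof.
move=> /eqP; rewrite eq_complex /= eqxx andbT sqrtr_eq0 => Z0.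
apply/val_inj/funext => j /=; apply/eqP; rewrite -sqnormc_eq0.
rewrite eq_le sqnormc_ge0 andbT -lee_fin.
apply: le_trans (_ : (ell2_sqnorm Z)%:E <= _)%E; last by rewrite lee_fin.
rewrite ell2_sqnormE; apply: esum_ge; exists [set j]; first by split.
by rewrite fsbig_set1.
Qed.

Lemma ell2_normD Z W : ell2_norm (Z + W) <= ell2_norm Z + ell2_norm W.
Proof.
have [/ell2_norm0_eq0->|Z0] := eqVneq (ell2_norm Z) 0.
  by rewrite add0r lerDr lecR sqrtr_ge0.
have [/ell2_norm0_eq0->|W0] := eqVneq (ell2_norm W) 0.
  by rewrite addr0 lerDl lecR sqrtr_ge0.
set s := Num.sqrt (ell2_sqnorm Z); set t := Num.sqrt (ell2_sqnorm W).
have s0 : 0 < s.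
  by rewrite lt0r sqrtr_ge0 andbT; apply: contra_neq Z0 => s0; rewrite /ell2_norm -/s s0.
have t0 : 0 < t.
  by rewrite lt0r sqrtr_ge0 andbT; apply: contra_neq W0 => t0; rewrite /ell2_norm -/t t0.
rewrite /ell2_norm -rmorphD lecR -/s -/t.
have st0 : 0 <= s + t by rewrite addr_ge0// ltW.
rewrite -[leRHS](ger0_norm st0) -sqrtr_sqr ler_wsqrtr//.
rewrite -lee_fin ell2_sqnormE.
apply: le_trans (ell2_sumD_le Z W s0 t0) _.
rewrite -!ell2_sqnormE -!EFinM -EFinD lee_fin.
rewrite -(sqr_sqrtr (ell2_sqnorm_ge0 Z)) -(sqr_sqrtr (ell2_sqnorm_ge0 W)) -/s -/t.
rewrite le_eqVlt; apply/orP; left; apply/eqP.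
by field; rewrite !gt_eqF.
Qed.

Lemma ell2_normZ a Z : ell2_norm (a *: Z) = `|a| * ell2_norm Z.
Proof.
rewrite /ell2_norm normcE_sqnormc -rmorphM -sqrtrM ?sqnormc_ge0//.
by congr (Num.sqrt _)%:C; apply: EFin_inj; rewrite EFinM !ell2_sqnormE ell2_sumZ.
Qed.

HB.instance Definition _ :=
  Lmodule_isNormed.Build R[i] ell2 ell2_normD ell2_normZ ell2_norm0_eq0.

End ell2.

Section ddbar.
Variables (R : realType) (V : lmodType R[i]).
Implicit Types (f : V -> R[i]) (p v w : V).

(* derivative along the real direction [v], i.e. at [t = 0] of the function
   [f (p + t v)] of the real variable [t] *)
Definition rderive f v p : R[i] :=
  (derive1 (fun t : R => complex.Re (f (p + t%:C *: v))) 0) +i*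
  (derive1 (fun t : R => complex.Im (f (p + t%:C *: v))) 0).

(* the Wirtinger derivatives (∂f)(v) and (∂̄f)(v) *)
Definition del f v p : R[i] :=
  (rderive f v p - 'i * rderive f ('i *: v) p) / 2%:R.

Definition delbar f v p : R[i] :=
  (rderive f v p + 'i * rderive f ('i *: v) p) / 2%:R.

(* The 2-form ∂∂̄f = sum_{a,b} (∂²f/∂z_a∂z̄_b) dz_a /\ dz̄_b evaluated at (v,w),
   with the convention (α /\ β)(v,w) = α(v)β(w) - α(w)β(v). *)
Definition ddbar f p v w : R[i] :=
  del (delbar f w) v p - del (delbar f v) w p.

Definition kahler_form (f : V -> R) p v w : R[i] :=
  'i / 2%:R * ddbar (fun z => (f z)%:C) p v w.

End ddbar.

Section projective.
Variables (R : realType) (I : choiceType).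

(* The projective space of [ell2 R I], as the set of its complex lines:
   CP^N for [I = 'I_N.+1] and CP^oo for [I = nat]. *)
Definition CP := {L : set (ell2 R I) |
  exists2 Z, Z != 0 & L = [set c *: Z | c in [set: R[i]]]}.

(* The metric g = ω(·, J·) of ω = (i/2)∂∂̄ log |Z|^2, pulled back to
   homogeneous coordinates [Z != 0]. *)
Definition fubini_study (Z V W : ell2 R I) : R :=
  complex.Re (kahler_form (fun Z => ln (ell2_sqnorm Z)) Z V ('i *: W)).

End projective.

Section submanifolds.
Variables (R : realType) (n m : nat).
Local Notation C := R[i].
Implicit Types (X : set 'rV[C]_m) (A : set 'rV[C]_m) (U : set 'rV[C]_n).

(* [phi] restricts to a holomorphic chart of the [n]-dimensional complex
   submanifold [X] of C^m, from [X `&` A] onto [U], with inverse [gam]. *)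
Definition holomorphic_chart X A (phi : 'rV[C]_m -> 'rV[C]_n)
    U (gam : 'rV[C]_n -> 'rV[C]_m) : Prop :=
  [/\ open A, open U,
      (forall z, A z -> differentiable phi z),
      (forall u, U u -> differentiable gam u) &
      [/\ (forall z, X z -> A z -> U (phi z) /\ gam (phi z) = z) &
          (forall u, U u -> [/\ X (gam u), A (gam u) & phi (gam u) = u])]].

(* A metric on [X] is a real-valued function of a point of [X] and of two
   vectors of C^m tangent to [X] there; its values elsewhere are irrelevant. *)
Definition metric_field := 'rV[C]_m -> 'rV[C]_m -> 'rV[C]_m -> R.

(* [g] is positive definite and its associated form g(J·, ·) is (i/2)∂∂̄Phi,
   both expressed in the charts of [X]. Such a form being real, closed and of
   type (1,1), [g] is then a Kähler metric. *)
Definition kahler_metric_with_potential X (g : metric_field)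
    (Phi : 'rV[C]_m -> R) : Prop :=
  forall A phi U gam, holomorphic_chart X A phi U gam -> forall u, U u ->
    (forall v, v != 0 -> 0 < g (gam u) ('d gam u v) ('d gam u v)) /\
    (forall v w, (g (gam u) ('i *: 'd gam u v) ('d gam u w))%:C =
                 kahler_form (Phi \o gam) u v w).

Section maps.
Variables (I : choiceType) (X : set 'rV[C]_m) (psi : 'rV[C]_m -> CP R I).

(* Near [u], [psi \o gam] takes its values in the affine chart [Z_j != 0] and
   [F] gives its homogeneous coordinates normalized by [Z_j = 1]: the other
   components of [F] are the affine coordinates of [psi \o gam]. *)
Definition affine_expression (gam : 'rV[C]_n -> 'rV[C]_m) (u : 'rV[C]_n)
    (j : I) (F : 'rV[C]_n -> ell2 R I) : Prop :=
  \forall u' \near u, sval (psi (gam u')) (F u') /\ F u' j = 1.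

Definition holomorphic_to_CP : Prop :=
  forall A phi U gam, holomorphic_chart X A phi U gam -> forall u, U u ->
  exists j F, affine_expression gam u j F /\
    \forall u' \near u, differentiable F u'.

Definition immersion_to_CP : Prop :=
  forall A phi U gam, holomorphic_chart X A phi U gam -> forall u, U u ->
  forall j F, affine_expression gam u j F -> injective ('d F u).

Definition pulls_back_fubini_study (g : metric_field) : Prop :=
  forall A phi U gam, holomorphic_chart X A phi U gam -> forall u, U u ->
  forall j F, affine_expression gam u j F -> forall v w,
    fubini_study (F u) ('d F u v) ('d F u w) =
    g (gam u) ('d gam u v) ('d gam u w).

End maps.

Definition induced_by_CP (I : choiceType) X (g : metric_field) : Prop :=
  exists psi : 'rV[C]_m -> CP R I,
    [/\ holomorphic_to_CP X psi, immersion_to_CP X psi &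
        pulls_back_fubini_study X psi g].

Definition projectively_induced X (g : metric_field) : Prop :=
  (exists N : nat, induced_by_CP 'I_N.+1 X g) \/ induced_by_CP nat X g.

End submanifolds.

Arguments kahler_metric_with_potential {R} n {m} X g Phi.
Arguments projectively_induced {R} n {m} X g.

Definition kepler (R : realType) (n : nat) : set 'rV[R[i]]_n.+1 :=
  [set z | z != 0 /\ \sum_i z 0 i ^+ 2 = 0].

Arguments kepler R n : clear implicits.

Definition norm_im (R : realType) (m : nat) (z : 'rV[R[i]]_m) : R :=
  Num.sqrt (\sum_i complex.Im (z 0 i) ^+ 2).

(* Main.v *)
Require Import Defs.
From HB Require Import structures.
From mathcomp Require Import all_boot all_order all_algebra.
From mathcomp Require Import complex.
From mathcomp Require Import all_classical all_reals all_analysis.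
From mathcomp Require Import ring lra.

(* Along the complex line spanned by (1, i, 0, ..., 0), the Kepler manifold
   contains a copy of C \ {0} on which the potential is |b|/2 and the metric is
   |db|^2 / (8 |b|): a flat cone of total angle pi. Suppose that psi pulls the
   Fubini-Study metric back to it. As the punctured disc 0 < |b| <= r has a small
   diameter for this metric, psi maps it, for r small, into a single affine chart
   <Z, Z0> = 1, in which it is given by a bounded holomorphic map F into l^2. But
   a bounded holomorphic map on a punctured disc has a bounded derivative near
   the puncture, whereas |F'(b)|^2 >= 1 / (8 |b|) because psi is isometric.

   The bound on the derivative comes from Cauchy's formula, centred at the
   puncture. The isometry condition bounds |F'| away from the puncture, so the
   circle averages of F can be differentiated under the integral although F' is
   not known to be continuous. *)

Set Implicit Arguments.
Unset Strict Implicit.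
Unset Printing Implicit Defensive.

Import Order.TTheory GRing.Theory Num.Theory numFieldNormedType.Exports.

Local Open Scope classical_set_scope.
Local Open Scope ring_scope.
Local Open Scope complex_scope.

(** Cauchy's estimate on a disc around [a] that avoids the puncture has radius at most |a| and gives
    only |F'(a)| <= C / |a|, which is compatible with growth like |a|^(-1/2). Circles of fixed
    radius around the puncture give a bound independent of [a]; the price is to show that the
    puncture contributes nothing to the integral. The problem in l^2 is made scalar by pairing F
    with the fixed vector v = F'(a): the function <F, v> is bounded by a multiple of |v|, and its
    derivative at [a] is the real number |v|^2. Hence |v| is bounded by a constant, and real parts
    of circle integrals suffice. The small diameter comes from the coordinate w with b = w^2, in
    which the cone is a flat half-plane with folded boundary: each b has a square root with Re w >=
    0, which a straight segment joins to the base point without meeting 0 on the way. As psi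
    provides only local lifts, what is followed along the segment is the squared cosine of the
    distance to the base line, a quantity that does not depend on the lift. *)

Lemma is_derive_inv (K : numFieldType) (f : K -> K) (x t v : K) :
  f x != 0 -> is_derive x v f t ->
  is_derive x v (fun y => (f y)^-1) (- (f x) ^- 2 *: t).
Proof.
by move=> fx0 [df <-]; split; [exact: derivableV | rewrite deriveV].
Qed.

(** * Real derivatives, integrals of periodic functions, the mean value inequality *)

Section real_lemmas.
Variable R : realType.
Local Notation mu := (@lebesgue_measure R).

Lemma is_derive1P (f : R -> R) (t l : R) :
  is_derive t 1 f l <->
  (forall e, 0 < e -> exists2 d, 0 < d &
     forall h, `|h| < d -> `|f (t + h) - f t - h * l| <= e * `|h|).
Proof.
split=> [fl e e0|fl].
  have [+ ] := fl => /[dup] /derivable1P df + dfl.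
  have : h^-1 *: ((f \o shift t) (h *: (1:R)) - f t) @[h --> 0^'] --> l.
    by rewrite -dfl; exact: ex_derive.
  move=> /cvgrPdist_le /(_ e e0).
  rewrite /dnbhs /within /= => -[d d0 fd] _; exists d => // h hd.
  have [->|h0] := eqVneq h 0.
    by rewrite addr0 subrr mul0r subrr normr0 mulr0.
  have := fd h; rewrite /= distrC subr0 => /(_ hd h0).
  rewrite /= /shift /= /GRing.scale /= mulr1 [h + t]addrC => H.
  rewrite -ler_pdivrMr ?normr_gt0//.
  rewrite -normrV ?unitfE// -normrM.
  apply: le_trans H; rewrite distrC.
  by rewrite le_eqVlt; apply/orP; left; apply/eqP; congr `|_|; field.
have key : h^-1 *: ((f \o shift t) (h *: (1:R)) - f t) @[h --> 0^'] --> l.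
  apply/cvgrPdist_le => e e0; have [d d0 fd] := fl _ e0.
  rewrite /dnbhs /within /=; exists d => // h /=; rewrite distrC subr0 => hd h0.
  rewrite /shift /= /GRing.scale /= mulr1 [h + t]addrC distrC.
  have := fd _ hd; rewrite -ler_pdivrMr ?normr_gt0// -normrV ?unitfE// -normrM.
  move=> H; apply: le_trans H.
  by rewrite le_eqVlt; apply/orP; left; apply/eqP; congr `|_|; field.
split; first by apply/cvg_ex; exists l.
exact/cvg_lim.
Qed.

Lemma is_derive_quadratic (f : R -> R) (a b c t : R) :
  (forall s, f s = a + s * b + s ^+ 2 * c) -> is_derive t 1 f (b + 2 * t * c).
Proof.
move=> fE; apply/is_derive1P => e e0; have c0 : 0 < `|c| + 1 by rewrite ltr_pwDr.
exists (e / (`|c| + 1)); first by rewrite divr_gt0.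
move=> h; rewrite ltr_pdivlMr// => he; rewrite !fE.
have -> : a + (t + h) * b + (t + h) ^+ 2 * c - (a + t * b + t ^+ 2 * c) -
    h * (b + 2 * t * c) = h * c * h by ring.
rewrite normrM ler_wpM2r// normrM; apply: le_trans (ltW he).
by rewrite ler_wpM2l// lerDl.
Qed.

Lemma Rintegral_shift (G : R -> R) (c a b : R) : a <= b -> continuous G ->
  \int[mu]_(x in `[a + c, b + c]) G x = \int[mu]_(x in `[a, b]) G (x + c).
Proof.
move=> ab cG; have dF : derive1 (fun x : R => x + c) = cst 1.
  by apply/funext => x; rewrite derive1E derive_val addr0.
have cF : continuous (fun x : R => x + c) by move=> x; apply: cvgD => //; exact: cvg_cst.
rewrite /Rintegral (@integration_by_substitution_increasing _ (fun x => x + c))//.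
- congr fine; apply: eq_integral => x _; congr EFin.
  by rewrite !fctE dF /= mulr1.
- by move=> x y _ _ xy; rewrite ltrD2r.
- by rewrite dF => ? _; exact: cvg_cst.
- by rewrite dF; exact: is_cvg_cst.
- by rewrite dF; exact: is_cvg_cst.
- split.
  + by move=> x _; apply: derivableD.
  + exact/cvg_at_right_filter/cF.
  + exact/cvg_at_left_filter/cF.
- exact: continuous_subspaceT.
Qed.

Lemma continuous_integrable_itv (G : R -> R) (a b : R) : continuous G ->
  mu.-integrable `[a, b] (EFin \o G).
Proof.
move=> cG; apply: continuous_compact_integrable; first exact: segment_compact.
exact: continuous_subspaceT.
Qed.

(** This is the rotation invariance of circle integrals: the shifted interval is cut at [p] and the
    piece beyond it is moved back by one period. A negative shift [e] is replaced by [e + p]. *)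
Lemma Rintegral_periodic (G : R -> R) (p e : R) : 0 < p -> continuous G ->
  (forall x, G (x + p) = G x) -> `|e| <= p ->
  \int[mu]_(x in `[0, p]) G (x + e) = \int[mu]_(x in `[0, p]) G x.
Proof.
move=> p0 cG Gp.
have pos d : 0 <= d <= p ->
    \int[mu]_(x in `[0, p]) G (x + d) = \int[mu]_(x in `[0, p]) G x.
  move=> /andP[d0 dp]; rewrite -Rintegral_shift ?ltW// add0r.
  have split1 a b m : a <= m -> m <= b -> \int[mu]_(x in `[a, b]) G x =
      \int[mu]_(x in `[a, m]) G x + \int[mu]_(x in `[m, b]) G x.
    move=> am mb.
    have := @Rintegral_itvB _ G (BLeft a) (BRight b) m
      (continuous_integrable_itv _ _ cG).
    rewrite !bnd_simp => /(_ am mb) /eqP; rewrite subr_eq addrC => /eqP ->.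
    rewrite Rintegral_itv_obnd_cbnd//.
    by apply: integrableS (continuous_integrable_itv m b cG) => //; exact: subset_itv_oc_cc.
  rewrite (split1 d (p + d) p)// ?lerDl//.
  have -> : \int[mu]_(x in `[p, p + d]) G x = \int[mu]_(x in `[0, d]) G x.
    rewrite -[p in `[p, _]]add0r [p + d]addrC Rintegral_shift//.
    by apply: eq_Rintegral => x _.
  by rewrite addrC -split1.
move=> ep; case: (leP 0 e) => e0.
  by apply: pos; rewrite e0 (le_trans (ler_norm _) ep).
rewrite -(pos (e + p)); last by move: ep; rewrite ltr0_norm//; lra.
by apply: eq_Rintegral => x _; rewrite addrA Gp.
Qed.

Lemma is_derive_le_lipschitz (f f' : R -> R) (a b k : R) : a <= b ->
  (forall x, a <= x <= b -> is_derive x 1 f (f' x)) ->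
  (forall x, a <= x <= b -> `|f' x| <= k) ->
  `|f b - f a| <= k * (b - a).
Proof.
move=> ab df fk; have [||c] := @MVT_segment _ f f' a b ab.
- by move=> x; rewrite in_itv /= => /andP[? ?]; apply: df; rewrite !ltW.
- apply: derivable_within_continuous => x; rewrite in_itv /= => xab.
  by have [] := df x xab.
- rewrite in_itv /= => cab ->; rewrite normrM (ger0_norm (x := b - a)) ?subr_ge0//.
  by rewrite ler_wpM2r ?subr_ge0// fk.
Qed.

End real_lemmas.

(** * Complex differentiability *)

Section complex_lemmas.
Variable R : realType.
Local Notation C := R[i].
Local Notation mu := (@lebesgue_measure R).

Definition cnorm (z : C) : R := Normc.normc z.

Lemma cnormE (z : C) : `|z| = (cnorm z)%:C.
Proof. by case: z. Qed.

Lemma cnormM (z w : C) : cnorm (z * w) = cnorm z * cnorm w.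
Proof. exact: Normc.normcM. Qed.

Lemma cnormV (z : C) : cnorm z^-1 = (cnorm z)^-1.
Proof. exact: Normc.normcV. Qed.

Lemma cnorm0 : cnorm 0 = 0.
Proof. exact: Normc.normc0. Qed.

Lemma sqr_cnorm (z : C) : cnorm z ^+ 2 = sqnormc z.
Proof. by rewrite /cnorm; case: z => x y /=; rewrite sqr_sqrtr// addr_ge0 ?sqr_ge0. Qed.

Lemma cnorm_ge0 (z : C) : 0 <= cnorm z.
Proof. by rewrite /cnorm; case: z => x y /=; rewrite sqrtr_ge0. Qed.

Lemma cnorm_triangle (z w : C) : cnorm (z + w) <= cnorm z + cnorm w.
Proof. exact: (@le_normcD R z w). Qed.

Lemma cnorm_opp (z : C) : cnorm (- z) = cnorm z.
Proof. by rewrite /cnorm; case: z => x y /=; rewrite !sqrrN. Qed.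

Lemma cnorm_Re (z : C) : `|complex.Re z| <= cnorm z.
Proof.
by rewrite /cnorm; case: z => x y /=; rewrite -sqrtr_sqr ler_wsqrtr// lerDl sqr_ge0.
Qed.

Lemma cnorm_real (x : R) : cnorm x%:C = `|x|.
Proof. by rewrite /cnorm /= expr0n /= addr0 sqrtr_sqr. Qed.

Lemma cnorm_le (z : C) : cnorm z <= `|complex.Re z| + `|complex.Im z|.
Proof.
rewrite -(ger0_norm (cnorm_ge0 z)) -[leRHS]ger0_norm ?addr_ge0//.
rewrite -ler_sqr ?nnegrE// !real_normK ?num_real// sqr_cnorm /sqnormc sqrrD.
by rewrite !real_normK ?num_real// -addrA lerD2l lerDr mulrn_wge0// mulr_ge0.
Qed.

Lemma cnorm_eq0 (z : C) : (cnorm z == 0) = (z == 0).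
Proof. by apply/eqP/eqP => [/Normc.eq0_normc//|->]; rewrite cnorm0. Qed.

Lemma cnorm_gt0 (z : C) : (0 < cnorm z) = (z != 0).
Proof. by rewrite lt_neqAle cnorm_ge0 andbT eq_sym cnorm_eq0. Qed.

Lemma cnormB (z w : C) : cnorm z - cnorm w <= cnorm (z - w).
Proof. by rewrite lerBlDr -{1}[z](subrK w) cnorm_triangle. Qed.

Lemma cnormC (z w : C) : cnorm (z - w) = cnorm (w - z).
Proof. by rewrite -opprB cnorm_opp. Qed.

Lemma nbhs_cnorm (z : C) (P : set C) : nbhs z P ->
  exists2 d : R, 0 < d & forall h, cnorm h < d -> P (z + h).
Proof.
move=> [d /= d0 H1].
(* The norm of [R[i]] takes values in [R[i]], so radii are complex; being positive, they are
   real. *)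
have dE : d = (complex.Re d)%:C.
  by apply/eqP; rewrite eq_complex /= eqxx /=; move: d0; rewrite ltcE /= => /andP[].
exists (complex.Re d); first by move: d0; rewrite ltcE /= => /andP[].
move=> h hd; apply: H1 => /=.
by rewrite opprD addNKr normrN cnormE dE ltcR.
Qed.

(* Every real-linear form on C is [h |-> Re (alpha h)] for a unique [alpha]. *)
Definition real_diff (phi : C -> R) (z alpha : C) := forall e, 0 < e ->
  exists2 d, 0 < d & forall h, cnorm h < d ->
  `|phi (z + h) - phi z - complex.Re (alpha * h)| <= e * cnorm h.

Lemma real_diff_curve (phi : C -> R) (x y : R -> R) (t x' y' : R) (alpha : C) :
  is_derive t 1 x x' -> is_derive t 1 y y' ->
  real_diff phi (x t +i* y t) alpha ->
  is_derive t 1 (fun s => phi (x s +i* y s)) (complex.Re (alpha * (x' +i* y'))).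
Proof.
move=> /is_derive1P dx /is_derive1P dy dphi; apply/is_derive1P => e e0.
(* [L] adds up two errors: that of [phi] over an increment of length at most K + 2 times |h|, and
   [alpha] times those of [x] and [y]. *)
pose K := `|x'| + `|y'|; pose L := K + 2 + 2 * cnorm alpha.
have K0 : 0 <= K by rewrite addr_ge0.
have L0 : 0 < L by rewrite /L; have := cnorm_ge0 alpha; lra.
have [e1 [e10 e11 e1e]] : exists e1 : R, [/\ 0 < e1, e1 <= 1 & e1 * L <= e].
  exists (Num.min 1 (e / L)); split; first by rewrite lt_min ltr01 divr_gt0.
    by rewrite ge_min lexx.
  by rewrite -ler_pdivlMr// ge_min lexx orbT.
have [d1 d10 {}dx] := dx _ e10; have [d2 d20 {}dy] := dy _ e10.
have [d d0 {}dphi] := dphi _ e10.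
exists (Num.min (Num.min d1 d2) (d / (K + 2))).
  by rewrite !lt_min d10 d20 divr_gt0//; lra.
move=> h; rewrite !lt_min => /andP[/andP[/dx hx /dy hy]].
rewrite ltr_pdivlMr; last lra.
move=> hd.
set D := (x (t + h) - x t) +i* (y (t + h) - y t).
have bd (a b : R) : `|a - h * b| <= e1 * `|h| -> `|a| <= (`|b| + 1) * `|h|.
  move=> ab; rewrite -[a](subrK (h * b)) (le_trans (ler_normD _ _))// normrM.
  by have := ler_wpM2r (normr_ge0 h) e11; lra.
have DK : cnorm D <= (K + 2) * `|h|.
  by apply: le_trans (cnorm_le _) _; move: (bd _ _ hx) (bd _ _ hy) => /=; rewrite /K; lra.
have Dd : cnorm D < d by rewrite (le_lt_trans DK)// mulrC.
have := dphi D Dd.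
have -> : (x t +i* y t) + D = x (t + h) +i* y (t + h).
  by apply/eqP; rewrite eq_complex /=; apply/andP; split; apply/eqP; ring.
move=> hphi.
have E : D - h%:C * (x' +i* y') =
  (x (t + h) - x t - h * x') +i* (y (t + h) - y t - h * y').
  by apply/eqP; rewrite eq_complex /=; apply/andP; split; apply/eqP; ring.
have H2 : `|complex.Re (alpha * (D - h%:C * (x' +i* y')))| <=
    cnorm alpha * (2 * e1 * `|h|).
  apply: le_trans (cnorm_Re _) _; rewrite cnormM E.
  apply: ler_wpM2l; first exact: cnorm_ge0.
  by apply: le_trans (cnorm_le _) _ => /=; lra.
have -> : phi (x (t + h) +i* y (t + h)) - phi (x t +i* y t) -
   h * complex.Re (alpha * (x' +i* y')) =
   (phi (x (t + h) +i* y (t + h)) - phi (x t +i* y t) - complex.Re (alpha * D)) +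
   complex.Re (alpha * (D - h%:C * (x' +i* y'))).
  by case: (alpha) => a b /=; ring.
apply: le_trans (ler_normD _ _) _.
apply: (@le_trans _ _ (e1 * L * `|h|)); last by rewrite ler_wpM2r.
by have := ler_wpM2l (ltW e10) DK; rewrite /L; lra.
Qed.

Lemma is_deriveC_le (f : C -> C) (z f' : C) : is_derive z (1 : C) f f' ->
  forall e, 0 < e -> exists2 d, 0 < d & forall h, cnorm h < d ->
  cnorm (f (z + h) - f z - f' * h) <= e * cnorm h.
Proof.
move=> [df dfl] e e0.
have : h^-1 *: ((f \o shift z) (h *: (1 : C)) - f z) @[h --> (0:C)^'] --> f'.
  by rewrite -dfl; exact: df.
move=> /cvgrPdist_le /(_ e%:C); rewrite ltcR => /(_ e0).
rewrite /dnbhs /within /= => -[d /= d0 fd].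
have dE : d = (complex.Re d)%:C.
  by apply/eqP; rewrite eq_complex /= eqxx /=; move: d0; rewrite ltcE /= => /andP[].
exists (complex.Re d); first by move: d0; rewrite ltcE /= => /andP[].
move=> h hd; have [->|h0] := eqVneq h 0.
  by rewrite addr0 mulr0 !subrr cnorm0 mulr0.
have := fd h; rewrite /= distrC subr0 cnormE dE ltcR => /(_ hd h0).
rewrite cnormE lecR => H.
have -> : f (z + h) - f z - f' * h = - (f' - h^-1 *: ((f \o shift z) (h *: 1) - f z)) * h.
  by rewrite /= /shift /= /GRing.scale /= mulr1 [h + z]addrC; field.
by rewrite cnormM cnorm_opp ler_wpM2r// cnorm_ge0.
Qed.

Lemma le_is_deriveC (f : C -> C) (z f' : C) :
  (forall e, 0 < e -> exists2 d, 0 < d & forall h, cnorm h < d ->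
  cnorm (f (z + h) - f z - f' * h) <= e * cnorm h) -> is_derive z (1 : C) f f'.
Proof.
move=> fl.
have key : h^-1 *: ((f \o shift z) (h *: (1 : C)) - f z) @[h --> (0 : C)^'] --> f'.
  apply/cvgrPdist_le => e e0.
  have eE : e = (complex.Re e)%:C.
    by apply/eqP; rewrite eq_complex /= eqxx /=; move: e0; rewrite ltcE /= => /andP[].
  have [|d d0 fd] := fl (complex.Re e); first by move: e0; rewrite ltcE /= => /andP[].
  rewrite /dnbhs /within /=; exists d%:C; first by rewrite /= ltcR.
  move=> h /=; rewrite distrC subr0 cnormE ltcR => hd h0.
  rewrite eE /shift /= /GRing.scale /= mulr1 [h + z]addrC cnormE lecR.
  have := fd _ hd; rewrite -ler_pdivrMr ?cnorm_gt0// -cnormV -cnormM => H1.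
  apply: le_trans H1; rewrite cnormC.
  by rewrite le_eqVlt; apply/orP; left; apply/eqP; congr cnorm; field.
split; first by apply/cvg_ex; exists f'.
exact/cvg_lim.
Qed.

Lemma is_deriveC_real_diff (f : C -> C) (z f' : C) :
  is_derive z (1 : C) f f' -> real_diff (fun w => complex.Re (f w)) z f'.
Proof.
move=> df e /(is_deriveC_le df)[d d0 fd]; exists d => // h /fd; apply: le_trans.
by rewrite -!raddfB; exact: cnorm_Re.
Qed.

Definition circ (r t : R) : C := (r * cos t) +i* (r * sin t).

Lemma cnorm_circ r t : 0 <= r -> cnorm (circ r t) = r.
Proof.
move=> r0; rewrite /cnorm /= !exprMn -mulrDr cos2Dsin2 mulr1 sqrtr_sqr ger0_norm//.
Qed.

Lemma circ_2pi r t : circ r (t + 2 * pi) = circ r t.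
Proof. by rewrite /circ mulr_natl cosD2pi sinD2pi. Qed.

(** This is 2 pi times the real part of the circle average. The real part is enough because the
    final derivative bound is applied at a point where the derivative is a squared norm. *)
Definition mean (f : C -> C) (r : R) : R :=
  \int[mu]_(t in `[0, 2 * pi]) complex.Re (f (circ r t)).

(** Since Re (- 'i f) = Im f, the first and third items are the Cauchy-Riemann equation in polar
    coordinates: the angular derivative of Im f is [r] times the radial derivative of Re f. *)
Lemma is_derive_circ (f : C -> C) (f' : C) r t : is_derive (circ r t) (1 : C) f f' ->
  [/\ is_derive r 1 (fun s => complex.Re (f (circ s t))) (complex.Re (f' * circ 1 t)),
      is_derive t 1 (fun s => complex.Re (f (circ r s))) (complex.Re ('i * f' * circ r t)) &
      is_derive t 1 (fun s => complex.Re (- 'i * f (circ r s))) (complex.Re (f' * circ r t))].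
Proof.
move=> df; have := is_deriveC_real_diff df => dRf.
have dIf : is_derive (circ r t) (1 : C) (fun w => - 'i * f w) (- 'i * f').
  exact: is_deriveZ.
have {}dIf := is_deriveC_real_diff dIf.
have dx : is_derive r 1 (fun s : R => s * cos t) (cos t).
  by apply: is_derive_eq; rewrite !scaler0 add0r /GRing.scale /= mulr1.
have dy : is_derive r 1 (fun s : R => s * sin t) (sin t).
  by apply: is_derive_eq; rewrite !scaler0 add0r /GRing.scale /= mulr1.
have dxt : is_derive t 1 (fun s : R => r * cos s) (- (r * sin t)).
  by apply: is_derive_eq; rewrite /GRing.scale /= mulrN.
have dyt : is_derive t 1 (fun s : R => r * sin s) (r * cos t).
  by apply: is_derive_eq; rewrite /GRing.scale /=.
split.
- have := real_diff_curve dx dy dRf.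
  by rewrite /circ !mul1r.
- have := real_diff_curve dxt dyt dRf.
  congr is_derive; congr complex.Re; case: (f') => a b.
  by rewrite /circ; simpc; congr (_ +i* _); ring.
- have := real_diff_curve dxt dyt dIf.
  congr is_derive; congr complex.Re; case: (f') => a b.
  by rewrite /circ; simpc; congr (_ +i* _); ring.
Qed.

End complex_lemmas.

(** * Circle averages and removable singularities *)

Section mean_value.
Variable R : realType.
Local Notation C := R[i].
Local Notation mu := (@lebesgue_measure R).

Lemma cnorm_circ1 t : cnorm (circ 1 t : C) = 1.
Proof. exact: cnorm_circ. Qed.

Lemma integrable_cst_itv (a b k : R) : mu.-integrable `[a, b] (EFin \o cst k).
Proof. by apply: continuous_integrable_itv => x; exact: cvg_cst. Qed.

Section annulus.
Variables (f f' : C -> C) (u v B : R).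
Hypotheses (u0 : 0 <= u)
  (df : forall z, u < cnorm z < v -> is_derive z (1 : C) f (f' z))
  (f'B : forall z, u < cnorm z < v -> cnorm (f' z) <= B).

Let df_circ r t : u < r < v -> is_derive (circ r t) (1 : C) f (f' (circ r t)).
Proof.
by move=> urv; apply: df; rewrite cnorm_circ// (le_trans u0)//; case/andP: urv => /ltW.
Qed.

Let f'_circ r t : u < r < v -> cnorm (f' (circ r t)) <= B.
Proof.
by move=> urv; apply: f'B; rewrite cnorm_circ// (le_trans u0)//; case/andP: urv => /ltW.
Qed.

Let continuous_circ r : u < r < v -> continuous (fun t => complex.Re (f (circ r t))).
Proof.
move=> urv t; have [_ [dft _] _] := is_derive_circ (df_circ t urv).
by apply/differentiable_continuous/derivable1_diffP.
Qed.

Let continuous_circ' r : u < r < v ->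
  continuous (fun t => complex.Re (- 'i * f (circ r t))).
Proof.
move=> urv t; have [_ _ [dft _]] := is_derive_circ (df_circ t urv).
by apply/differentiable_continuous/derivable1_diffP.
Qed.

Let bound_f' r t : u < r < v -> `|complex.Re (f' (circ r t) * circ 1 t)| <= B.
Proof.
by move=> urv; rewrite (le_trans (cnorm_Re _))// cnormM cnorm_circ1 mulr1 f'_circ.
Qed.

(* By the Cauchy-Riemann equations the integrand is [1/r] times the derivative of
   [Im f] along the circle, whose average over the circle is unchanged by a
   rotation. *)
Let int_deriv0 r : u < r < v ->
  \int[mu]_(t in `[0, 2 * pi]) complex.Re (f' (circ r t) * circ 1 t) = 0.
Proof.
move=> urv; have r0 : 0 < r by case/andP: urv => /(le_lt_trans u0).
pose A (s t : R) : R := r^-1 * complex.Re (- 'i * f (circ r (t + s))).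
have dA (s t : R) : is_derive s 1 (A ^~ t)
    (complex.Re (f' (circ r (t + s)) * circ 1 (t + s))).
  have [_ _ d1] := is_derive_circ (df_circ (t + s) urv).
  have d2 : is_derive s 1 (fun s : R => t + s) (1 : R).
    rewrite -[X in is_derive _ _ _ X]add0r.
    exact: (is_deriveD (is_derive_cst t s 1) (is_derive_id s 1)).
  have d3 := @is_derive1_comp _ _ _ _ _ _ d1 d2.
  have : is_derive s 1
      (r^-1 *: ((fun x => complex.Re (- 'i * f (circ r x))) \o (fun s => t + s)))
      (r^-1 * (complex.Re (f' (circ r (t + s)) * circ r (t + s)) * 1)).
    exact: is_deriveZ.
  rewrite mulr1; congr is_derive; move: (f' _) => [a b].
  by rewrite /circ; simpc; rewrite /=; field; rewrite gt_eqF.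
have B0 : 0 <= B by apply: le_trans (bound_f' 0 urv).
have cA s : continuous (A s).
  pose A0 (t : R) : R := r^-1 * complex.Re (- 'i * f (circ r t)).
  move=> t; apply: (@continuous_comp _ _ _ (fun t => t + s) A0).
    by apply: cvgD; [exact: cvg_id | exact: cvg_cst].
  by apply: cvgMr; exact: continuous_circ'.
have := @differentiation_under_integral R _ _ mu A `[0, 2 * pi]%classic
  (measurable_itv _) 0 (- 1) 1.
rewrite /= in_itv /= oppr_lt0 ltr01 => /(_ isT).
move=> /(_ (fun s _ => continuous_integrable_itv _ _ (cA s))).
move=> /(_ (fun s t _ _ => @ex_derive _ _ _ _ _ _ _ (dA s t))).
move=> /(_ (cst B) (fun _ => B0) (integrable_cst_itv _ _ _)).
have dAE (s t : R) : partial1of2 A s t =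
    complex.Re (f' (circ r (t + s)) * circ 1 (t + s)).
  by rewrite partial1of2E; apply: derive_val.
have H (s t : R) : `]- 1, 1[%classic s -> `[0, 2 * pi]%classic t ->
    `|partial1of2 A s t| <= cst B t.
  move=> _ _; by rewrite dAE bound_f'.
move=> /(_ H) dJ.
transitivity (\int[mu]_(y in `[0, 2 * pi]) partial1of2 A 0 y).
  by apply: eq_Rintegral => t _; rewrite dAE addr0.
rewrite -dJ derive1E.
transitivity ('D_1 (cst (\int[mu]_(t in `[0, 2 * pi]) A 0 t)) (0 : R)); last first.
  by rewrite derive_cst.
apply: near_eq_derive; exists 1 => //= s /=; rewrite sub0r normrN => s1.
transitivity (\int[mu]_(t in `[0, 2 * pi]) A 0 (t + s)).
  by apply: eq_Rintegral => t _; rewrite /A addr0.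
rewrite Rintegral_periodic//; first by rewrite mulr_gt0// pi_gt0.
  by move=> t; rewrite /A !addr0 circ_2pi.
by have := pi_ge2 R; lra.
Qed.

Let is_derive_mean r : u < r < v -> is_derive r 1 (mean f) 0.
Proof.
move=> urv; have r0 : 0 < r by case/andP: urv => /(le_lt_trans u0).
pose A (s t : R) : R := complex.Re (f (circ s t)).
have Ir : `]u, v[%classic r by rewrite /= in_itv.
have dA (s t : R) : `]u, v[%classic s ->
    is_derive s 1 (A ^~ t) (complex.Re (f' (circ s t) * circ 1 t)).
  by rewrite /= in_itv /= => usv; have [] := is_derive_circ (df_circ t usv).
have B0 : 0 <= B by apply: le_trans (bound_f' 0 urv).
have iA s : `]u, v[%classic s -> mu.-integrable `[0, 2 * pi] (EFin \o A s).
  by rewrite /= in_itv /= => usv; apply/continuous_integrable_itv/continuous_circ.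
have H (s t : R) : `]u, v[%classic s -> `[0, 2 * pi]%classic t ->
    `|partial1of2 A s t| <= cst B t.
  move=> Is _; rewrite partial1of2E (@derive_val _ _ _ _ _ _ _ (dA s t Is)).
  by apply: bound_f'; move: Is; rewrite /= in_itv.
have dd (s t : R) : `]u, v[%classic s -> `[0, 2 * pi]%classic t -> derivable (A ^~ t) s 1.
  by move=> Is _; have [] := dA s t Is.
split.
  exact: (@derivable_under_integral R _ _ mu A _ (measurable_itv _) r u v Ir iA dd
   (cst B) (fun _ => B0) (integrable_cst_itv _ _ _) H).
rewrite -derive1E.
rewrite (@differentiation_under_integral R _ _ mu A _ (measurable_itv _) r u v Ir iA dd
   (cst B) (fun _ => B0) (integrable_cst_itv _ _ _) H).
rewrite -[RHS](int_deriv0 urv); apply: eq_Rintegral => t _.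
by rewrite partial1of2E (@derive_val _ _ _ _ _ _ _ (dA r t Ir)).
Qed.

(** Nothing is assumed for |z| <= u, so the lemma applies across the puncture and also to kernels
    with a pole of modulus at most [u]. *)
Lemma mean_const r1 r2 : u < r1 < v -> u < r2 < v -> mean f r1 = mean f r2.
Proof.
wlog r12 : r1 r2 / r1 <= r2.
  by move=> H h1 h2; case: (leP r1 r2) => [|/ltW] h; [exact: H | rewrite (H r2 r1)].
move=> /andP[ur1 r1v] /andP[ur2 r2v]; apply/eqP; rewrite eq_sym -subr_eq0 -normr_le0.
have := @is_derive_le_lipschitz R (mean f) (cst 0) r1 r2 0 r12.
rewrite mul0r; apply.
  move=> x /andP[r1x xr2]; apply: is_derive_mean.
  by rewrite (lt_le_trans ur1)// (le_lt_trans xr2).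
by move=> x _; rewrite normr0.
Qed.

End annulus.
End mean_value.

Section removable.
Variable R : realType.
Local Notation C := R[i].
Local Notation mu := (@lebesgue_measure R).

Definition real_cont (phi : C -> R) (z : C) := forall e, 0 < e ->
  exists2 d, 0 < d & forall h, cnorm h < d -> `|phi (z + h) - phi z| <= e.

Lemma real_diff_cont phi (z a : C) : real_diff phi z a -> real_cont phi z.
Proof.
move=> dphi e e0; have [d d0 H] := dphi 1 ltr01.
have a0 := cnorm_ge0 a.
exists (Num.min d (e / (1 + cnorm a))); first by rewrite lt_min d0 divr_gt0//; lra.
move=> h; rewrite lt_min ltr_pdivlMr; last lra.
move=> /andP[/H hd he].
have K : `|complex.Re (a * h)| <= cnorm a * cnorm h by rewrite -cnormM cnorm_Re.
rewrite -[phi _ - _](subrK (complex.Re (a * h))) (le_trans (ler_normD _ _))//.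
by move: hd he K; lra.
Qed.

Lemma real_cont_curve (phi : C -> R) (x y : R -> R) (t : R) :
  {for t, continuous x} -> {for t, continuous y} ->
  real_cont phi (x t +i* y t) -> {for t, continuous (fun s => phi (x s +i* y s))}.
Proof.
move=> cx cy cphi; apply/cvgrPdist_le => e /cphi[d d0 H].
have d20 : 0 < d / 2 by rewrite divr_gt0.
near=> s.
have -> : x s +i* y s = (x t +i* y t) + ((x s - x t) +i* (y s - y t)).
  by apply/eqP; rewrite eq_complex /=; apply/andP; split; apply/eqP; ring.
rewrite distrC; apply: H; apply: le_lt_trans (cnorm_le _) _ => /=.
have : `|x t - x s| < d / 2 by near: s; move/cvgrPdist_lt : cx; exact.
have : `|y t - y s| < d / 2 by near: s; move/cvgrPdist_lt : cy; exact.
by rewrite [`|x t - _|]distrC [`|y t - _|]distrC; lra.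
Unshelve. all: by end_near. Qed.

Lemma continuous_circ_angle (phi : C -> R) r :
  (forall t, real_cont phi (circ r t)) -> continuous (fun t => phi (circ r t)).
Proof.
move=> H t; apply: (@real_cont_curve phi (fun t => r * cos t) (fun t => r * sin t)).
- by apply: cvgMr; exact: continuous_cos.
- by apply: cvgMr; exact: continuous_sin.
- exact: H.
Qed.

Lemma continuous_circ_radius (phi : C -> R) r t :
  real_cont phi (circ r t) -> {for r, continuous (fun s => phi (circ s t))}.
Proof.
move=> H; apply: (@real_cont_curve phi (fun s => s * cos t) (fun s => s * sin t)).
- by apply: cvgMl; exact: cvg_id.
- by apply: cvgMl; exact: cvg_id.
- exact: H.
Qed.

Lemma integrable_circ (phi : C -> R) r : (forall t, real_cont phi (circ r t)) ->
  mu.-integrable `[0, 2 * pi] (EFin \o (fun t => phi (circ r t))).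
Proof. by move=> H; apply/continuous_integrable_itv/continuous_circ_angle. Qed.

Lemma mean_le (f : C -> C) r k :
  (forall t, real_cont (fun z => complex.Re (f z)) (circ r t)) ->
  (forall t, cnorm (f (circ r t)) <= k) -> `|mean f r| <= k * (2 * pi).
Proof.
move=> cf fk; have i := integrable_circ cf.
rewrite /mean (le_trans (le_normr_Rintegral _ i))//.
have -> : k * (2 * pi) = \int[mu]_(t in `[0, 2 * pi]) (cst k t).
  rewrite Rintegral_cst//= lebesgue_measure_itv /= lte_fin mulr_gt0 ?pi_gt0//.
  by rewrite -EFinD subr0.
apply: le_Rintegral => //.
- exact: integrable_norm.
- exact: integrable_cst_itv.
- by move=> t _; rewrite (le_trans (cnorm_Re _)).
Qed.

End removable.

(** * Cauchy's formula and the derivative bound on a punctured disc *)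

Section cauchy.
Variable R : realType.
Local Notation C := R[i].
Local Notation mu := (@lebesgue_measure R).

(** On a circle centred at 0 one has dz = i z dt, so Cauchy's kernel dz / (2 pi i (z - a)) becomes z
    / (z - a) times dt / (2 pi). *)
Lemma is_derive_kernel (a z : C) : z != a ->
  is_derive z (1 : C) (fun w => w / (w - a)) (- a / (z - a) ^+ 2).
Proof.
move=> za; have za0 : z - a != 0 by rewrite subr_eq0.
have d1 : is_derive z (1 : C) (fun w => w - a) (1 : C).
  rewrite -[X in is_derive _ _ _ X]subr0.
  exact: (is_deriveB (is_derive_id z 1) (is_derive_cst a z 1)).
have d2 := @is_derive_inv _ (fun w => w - a) z 1 1 za0 d1.
have := is_deriveM (is_derive_id z (1 : C)) d2.
by congr is_derive; rewrite /GRing.scale /=; field.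
Qed.

Lemma is_derive_quot (f : C -> C) (f' a z : C) : z != a ->
  is_derive z (1 : C) f f' ->
  is_derive z (1 : C) (fun w => (f w - f a) * (w / (w - a)))
   (f' * (z / (z - a)) + (f z - f a) * (- a / (z - a) ^+ 2)).
Proof.
move=> za df.
have d1 : is_derive z (1 : C) (fun w => f w - f a) f'.
  rewrite -[X in is_derive _ _ _ X]subr0.
  exact: (is_deriveB df (is_derive_cst (f a) z 1)).
have := is_deriveM d1 (is_derive_kernel za).
by congr is_derive; rewrite /GRing.scale /= addrC [in LHS]mulrC.
Qed.

Lemma meanB (f g : C -> C) s :
  (forall t, real_cont (fun z => complex.Re (f z)) (circ s t)) ->
  (forall t, real_cont (fun z => complex.Re (g z)) (circ s t)) ->
  mean (fun z => f z - g z) s = mean f s - mean g s.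
Proof.
move=> /integrable_circ cf /integrable_circ cg; rewrite /mean -RintegralB//.
by apply: eq_Rintegral => t _; rewrite raddfB.
Qed.

Lemma real_cont_kernel (a c z : C) : z != a ->
  real_cont (fun z => complex.Re (c * (z / (z - a)))) z.
Proof.
move=> za; apply/real_diff_cont/is_deriveC_real_diff.
exact: (is_deriveZ c (is_derive_kernel za)).
Qed.

(** The mean does not change when the circle grows, and the integrand tends to [c] at infinity. *)
Lemma mean_kernel (a c : C) s : cnorm a < s ->
  mean (fun z => c * (z / (z - a))) s = complex.Re c * (2 * pi).
Proof.
move=> as_; have a0 := cnorm_ge0 a; have c0 := cnorm_ge0 c.
have ne z q : cnorm a < q -> q <= cnorm z -> z != a.
  by move=> aq qz; apply: contraTneq qz => ->; rewrite -ltNge.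
have cst_mean q : cnorm a < q ->
    mean (fun z => c * (z / (z - a))) q = mean (fun z => c * (z / (z - a))) s.
  move=> aq; pose u := (cnorm a + Num.min q s) / 2.
  have [m1 m2] : Num.min q s <= q /\ Num.min q s <= s by rewrite !ge_min !lexx orbT.
  have m3 : cnorm a < Num.min q s by rewrite lt_min aq.
  pose D := u - cnorm a.
  have D0 : 0 < D by rewrite /D /u; lra.
  apply: (@mean_const R _ (fun z => c * (- a / (z - a) ^+ 2)) u (q + s + 1)
    (cnorm c * (cnorm a / D ^+ 2))); rewrite /u; try lra.
    move=> z /andP[uz _]; apply: is_deriveZ; apply: is_derive_kernel.
    by apply: (ne _ u) => //; [rewrite /u; lra | exact: ltW].
  move=> z /andP[uz _]; rewrite !cnormM cnormV cnorm_opp ler_wpM2l// ler_wpM2l//.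
  have zD : D <= cnorm (z - a) by apply: le_trans (cnormB _ _); rewrite /D /u; lra.
  rewrite expr2 cnormM -expr2 lef_pV2 ?posrE ?exprn_gt0//; last by apply: lt_le_trans zD.
  by rewrite lerXn2r ?nnegrE ?cnorm_ge0// ltW.
apply/eqP; rewrite -subr_eq0 -normr_le0; apply/ler_addgt0Pr => e e0; rewrite add0r.
pose K := cnorm c * cnorm a * (2 * pi).
have K0 : 0 <= K by rewrite !mulr_ge0// pi_ge0.
pose q := cnorm a + K / e + 1.
have Ke : 0 <= K / e by rewrite divr_ge0// ltW.
(* As q - |a| = K / e + 1, on the circle of radius [q] the integrand differs from [c] by at most |c|
   |a| / (K / e + 1), and integration turns this into K / (K / e + 1) <= e. *)
have aq : cnorm a < q by rewrite /q; lra.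
have q0 : 0 <= q by rewrite /q; lra.
have cq t : q <= cnorm (circ q t) by rewrite cnorm_circ.
have cc : forall t, real_cont (fun z : C => complex.Re c) (circ q t).
  by move=> t e' e'0; exists 1 => // h _; rewrite subrr normr0 ltW.
have ck : forall t, real_cont (fun z => complex.Re (c * (z / (z - a)))) (circ q t).
  by move=> t; apply: real_cont_kernel; exact: ne (cq t).
rewrite -(cst_mean q)//.
have -> : complex.Re c * (2 * pi) = mean (cst c) q.
  rewrite /mean Rintegral_cst//= lebesgue_measure_itv /= lte_fin mulr_gt0 ?pi_gt0//.
  by rewrite -EFinD subr0.
rewrite -meanB//.
have E : K / (K / e + 1) <= e.
  by rewrite ler_pdivrMr; [have -> : e * (K / e + 1) = K + e by field; rewrite gt_eqF//|]; lra.
apply: le_trans E; rewrite /K mulrAC; apply: mean_le => t.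
  apply: real_diff_cont; apply: is_deriveC_real_diff.
  exact: (is_deriveB (is_deriveZ c (is_derive_kernel (ne _ _ aq (cq t))))
    (is_derive_cst c _ _)).
have za : circ q t - a != 0 by rewrite subr_eq0; exact: ne (cq t).
have -> : c * (circ q t / (circ q t - a)) - cst c (circ q t) = c * a / (circ q t - a).
  by rewrite /cst; field.
rewrite cnormM cnormV cnormM; apply: ler_pM => //; rewrite ?mulr_ge0 ?invr_ge0 ?cnorm_ge0//.
rewrite lef_pV2 ?posrE ?cnorm_gt0//; last by rewrite -/K; lra.
apply: le_trans (cnormB _ _); rewrite cnorm_circ// /q -/K; lra.
Qed.

Variables (f f' : C -> C) (r M : R).
Hypotheses
  (df : forall z, 0 < cnorm z < r -> is_derive z (1 : C) f (f' z))
  (fM : forall z, 0 < cnorm z < r -> cnorm (f z) <= M)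
  (f'B : forall p, 0 < p -> exists B, forall z, p < cnorm z < r -> cnorm (f' z) <= B).

Section point.
Variable a : C.
Hypothesis ar : 0 < cnorm a < r.

Let M0 : 0 <= M. Proof. exact: le_trans (cnorm_ge0 _) (fM ar). Qed.

(* [h] extends [(f z - f a) z / (z - a)] continuously to [a]: its circle averages
   vanish for radii less than [|a|] by boundedness near [0], hence for all radii
   by continuity across [|z| = |a|]. *)
Let h z := if z == a then a * f' a else (f z - f a) * (z / (z - a)).
Let h' z := f' z * (z / (z - a)) + (f z - f a) * (- a / (z - a) ^+ 2).

Let dh z : 0 < cnorm z < r -> z != a -> is_derive z (1 : C) h (h' z).
Proof.
move=> zr za; apply: near_eq_is_derive (is_derive_quot za (df zr)).
exists `|z - a|; first by rewrite /= normr_gt0 subr_eq0.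
move=> w /=; rewrite distrC /h; case: eqP => // ->.
by rewrite distrC ltxx.
Qed.

Let near_a : exists2 d, 0 < d & forall z, z != a -> cnorm (z - a) < d ->
  cnorm (f z - f a) <= (cnorm (f' a) + 1) * cnorm (z - a).
Proof.
have [d d0 fd] := is_deriveC_le (df ar) ltr01; exists d => // z za zd.
have := fd _ zd; rewrite [a + _]addrC subrK => H.
rewrite -[f z - f a](subrK (f' a * (z - a))) (le_trans (cnorm_triangle _ _))//.
by rewrite cnormM; lra.
Qed.

(** This is the dominating constant for continuity of the mean in the radius. It has to cover the
    circle through [a], where [h] is not known to be differentiable; near [a] it comes from the
    difference quotient of [f], elsewhere from [M]. *)
Let h_bound : exists G, forall z, 0 < cnorm z < r -> cnorm (h z) <= G.
Proof.
have [d d0 fd] := near_a.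
exists (r * (cnorm (f' a) + 1 + 2 * M / d)) => z /andP[z0 zr].
have r0 : 0 < r by lra.
have fa0 := cnorm_ge0 (f' a).
have Md : 0 <= 2 * M / d by rewrite divr_ge0 ?mulr_ge0// ltW.
rewrite /h; case: eqP => [zE|/eqP za].
  rewrite cnormM; apply: ler_pM; rewrite ?cnorm_ge0//; last lra.
  by rewrite -zE ltW.
have za0 : 0 < cnorm (z - a) by rewrite cnorm_gt0 subr_eq0.
rewrite !cnormM cnormV mulrCA; apply: ler_pM; rewrite ?cnorm_ge0//.
- by rewrite mulr_ge0 ?cnorm_ge0// invr_ge0 cnorm_ge0.
- exact: ltW.
have [zd|zd] := ltP (cnorm (z - a)) d.
  by rewrite ler_pdivrMr// (le_trans (fd _ za zd))// ler_wpM2r ?cnorm_ge0//; lra.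
apply: le_trans (_ : 2 * M / d <= _); last lra.
apply: ler_pM; rewrite ?cnorm_ge0 ?invr_ge0 ?cnorm_ge0//.
  apply: le_trans (cnorm_triangle _ _) _; rewrite cnorm_opp mulr_natl mulr2n.
  by rewrite lerD// fM// z0.
by rewrite lef_pV2// posrE.
Qed.

Let h_cont z : 0 < cnorm z < r -> real_cont (fun z => complex.Re (h z)) z.
Proof.
move=> zr; have [->|za] := eqVneq z a; last first.
  exact/real_diff_cont/is_deriveC_real_diff/dh.
move=> e e0; have a0 : 0 < cnorm a by case/andP: ar.
have e1 : 0 < e / (2 * (cnorm a + 1)) by rewrite divr_gt0//; lra.
have [d d0 fd] := is_deriveC_le (df ar) e1.
have fa0 := cnorm_ge0 (f' a).
have e2 : 0 < e / (2 * (cnorm (f' a) + 1)) by rewrite divr_gt0//; lra.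
exists (Num.min (Num.min d 1) (e / (2 * (cnorm (f' a) + 1)))).
  by rewrite !lt_min d0 ltr01.
move=> k; rewrite !lt_min ltr_pdivlMr; last lra.
move=> /andP[/andP[kd k1] ke]; rewrite -raddfB (le_trans (cnorm_Re _))// /h eqxx.
case: eqP => [_|/eqP ak]; first by rewrite subrr cnorm0 ltW.
have k0 : k != 0 by apply: contra ak => /eqP ->; rewrite addr0.
have -> : (f (a + k) - f a) * ((a + k) / (a + k - a)) - a * f' a =
  (f (a + k) - f a - f' a * k) / k * (a + k) + f' a * k.
  have -> : a + k - a = k by rewrite addrC addKr.
  by field.
have nk : 0 < cnorm k by rewrite cnorm_gt0.
apply: le_trans (cnorm_triangle _ _) _; rewrite !cnormM cnormV.
have H1 : cnorm (f (a + k) - f a - f' a * k) / cnorm k <= e / (2 * (cnorm a + 1)).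
  by rewrite ler_pdivrMr// fd.
have H2 : cnorm (a + k) <= cnorm a + 1.
  by apply: le_trans (cnorm_triangle _ _) _; lra.
have H3 : cnorm (f (a + k) - f a - f' a * k) / cnorm k * cnorm (a + k) <=
   e / (2 * (cnorm a + 1)) * (cnorm a + 1).
  by apply: ler_pM; rewrite ?cnorm_ge0// divr_ge0 ?cnorm_ge0.
have H4 : e / (2 * (cnorm a + 1)) * (cnorm a + 1) = e / 2.
  by field; rewrite gt_eqF//; lra.
by rewrite H4 in H3; lra.
Qed.

Let mean_h_cst u v r1 r2 : 0 < u -> v < r -> (v < cnorm a \/ cnorm a < u) ->
  u < r1 < v -> u < r2 < v -> mean h r1 = mean h r2.
Proof.
move=> u0 vr uva.
have [B f'_B] := f'B u0.
(* Both terms bound |z - a| from below on the annulus, by the reverse triangle inequality read in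
   either direction, and one of them is positive. *)
pose D := Num.max (cnorm a - v) (u - cnorm a).
have D0 : 0 < D by rewrite lt_max !subr_gt0; apply/orP.
have ub z : u < cnorm z < v -> 0 < cnorm z < r by lra.
have zD z : u < cnorm z < v -> D <= cnorm (z - a).
  move=> /andP[uz zv]; rewrite ge_max; apply/andP; split.
    by rewrite cnormC; apply: le_trans (cnormB _ _); lra.
  by apply: le_trans (cnormB _ _); lra.
have za z : u < cnorm z < v -> z != a.
  by move=> /zD; apply: contraTneq => ->; rewrite subrr cnorm0 -ltNge.
apply: (@mean_const R h h' u v (B * (r / D) + (2 * M) * (r / D ^+ 2)) (ltW u0)).
  by move=> z zuv; apply: dh; [exact: ub | exact: za].
move=> z zuv; have /andP[z0 zr] := ub _ zuv.
have B0 : 0 <= B by apply: le_trans (cnorm_ge0 _) (f'_B z _); lra.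
have iD : (cnorm (z - a))^-1 <= D^-1.
  by rewrite lef_pV2 ?posrE ?cnorm_gt0 ?subr_eq0 ?za// zD.
have i0 : 0 <= (cnorm (z - a))^-1 by rewrite invr_ge0 cnorm_ge0.
rewrite /h' (le_trans (cnorm_triangle _ _))// lerD//.
  rewrite !cnormM cnormV; apply: ler_pM; rewrite ?mulr_ge0 ?cnorm_ge0//.
    by apply: f'_B; lra.
  by apply: ler_pM; rewrite ?cnorm_ge0// ltW.
rewrite !cnormM cnormV cnorm_opp; apply: ler_pM;
  rewrite ?mulr_ge0 ?cnorm_ge0 ?invr_ge0 ?cnorm_ge0//.
  apply: le_trans (cnorm_triangle _ _) _; rewrite cnorm_opp mulr_natl mulr2n.
  by rewrite lerD// fM// z0.
apply: ler_pM; rewrite ?cnorm_ge0 ?invr_ge0 ?cnorm_ge0//.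
  by case/andP: ar => _ /ltW.
rewrite expr2 cnormM expr2 !invfM; exact: ler_pM.
Qed.

Let circ_in s t : 0 < s < r -> 0 < cnorm (circ s t : C) < r.
Proof. by move=> /andP[s0 sr]; rewrite cnorm_circ ?s0// ltW. Qed.

Let mean_h_inner s : 0 < s < cnorm a -> mean h s = 0.
Proof.
move=> /andP[s0 sa]; have /andP[a0 a_r] := ar.
apply/eqP; rewrite -normr_le0; apply/ler_addgt0Pr => e e0; rewrite add0r.
have K0 : 0 < 2 * M * (2 * pi) + 1 by rewrite ltr_pwDr// !mulr_ge0// pi_ge0.
pose k := e / (2 * M * (2 * pi) + 1).
have k0 : 0 < k by rewrite divr_gt0.
(* The factor z in [h] makes small circles negligible: p <= |a| / 2 gives |z - a| >= |a| / 2 on the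
   circle, and then p <= k |a| / 2 gives |z / (z - a)| <= k, so |h| <= 2 M k. *)
pose p := Num.min (Num.min s (cnorm a / 2)) (k * cnorm a / 2).
have p0 : 0 < p by rewrite !lt_min s0 !divr_gt0// mulr_gt0.
have ps : p <= s by rewrite !ge_min lexx.
have pa : p <= cnorm a / 2 by rewrite !ge_min lexx orbT.
have pk : p <= k * cnorm a / 2 by rewrite !ge_min lexx orbT.
rewrite (@mean_h_cst (p / 2) ((s + cnorm a) / 2) s p); try lra.
have H t : cnorm (h (circ p t)) <= 2 * M * k.
  have cp : cnorm (circ p t : C) = p by rewrite cnorm_circ// ltW.
  rewrite /h; case: eqP => [E|/eqP ca]; first by have := cp; rewrite E; lra.
  have pa' : cnorm a / 2 <= cnorm (circ p t - a).
    by rewrite cnormC; apply: le_trans (cnormB _ _); rewrite cp; lra.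
  rewrite !cnormM cnormV cp; apply: ler_pM; rewrite ?cnorm_ge0//.
  - by rewrite divr_ge0 ?cnorm_ge0// ltW.
  - apply: le_trans (cnorm_triangle _ _) _; rewrite cnorm_opp mulr_natl mulr2n.
    by rewrite lerD// fM// cp; lra.
  - rewrite ler_pdivrMr; last by lra.
    apply: le_trans pk _; rewrite -mulrA; apply: ler_wpM2l; [exact: ltW | exact: pa'].
apply: le_trans (mean_le _ H) _.
  by move=> t; apply: h_cont; rewrite circ_in//; lra.
have -> : 2 * M * k * (2 * pi) = e * (2 * M * (2 * pi)) / (2 * M * (2 * pi) + 1).
  by rewrite /k; ring.
by rewrite ler_pdivrMr// ler_pM2l// lerDl.
Qed.

Let mean_h s : 0 < s < r -> mean h s = 0.
Proof.
move=> /andP[s0 sr]; have /andP[a0 a_r] := ar.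
have [G hG] := h_bound.
have iA q : `]0, r[%classic q ->
    mu.-integrable `[0, 2 * pi] (EFin \o (fun t => complex.Re (h (circ q t)))).
  rewrite /= in_itv /= => qr; apply: (@integrable_circ R (fun z => complex.Re (h z))).
  by move=> t; apply: h_cont; rewrite circ_in.
have := @continuity_under_integral R _ _ mu (fun q t => complex.Re (h (circ q t)))
  `[0, 2 * pi] (measurable_itv _) 0 r iA.
have cA : \forall y \ae mu, `[0, 2 * pi]%classic y ->
   {in `]0, r[%classic, continuous (fun q => complex.Re (h (circ q y)))}.
  apply: aeW => t _ q; rewrite inE /= in_itv /= => qr.
  apply: (@continuous_circ_radius R (fun z => complex.Re (h z))).
  by apply: h_cont; rewrite circ_in.
move=> /(_ cA (cst G) (integrable_cst_itv _ _ _)).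
have gub q : `]0, r[%classic q -> \forall y \ae mu, `[0, 2 * pi]%classic y ->
    `|complex.Re (h (circ q y))| <= cst G y.
  rewrite /= in_itv /= => qr; apply: aeW => t _.
  by rewrite (le_trans (cnorm_Re _))// hG// circ_in.
move=> /(_ gub (cnorm a)); rewrite inE /= in_itv /= ar => /(_ isT) /cvgrPdist_le cont.
have close e : 0 < e -> exists2 d, 0 < d & forall q, `|cnorm a - q| < d ->
    `|mean h (cnorm a) - mean h q| <= e.
  by move=> /cont[d /= d0 H]; exists d.
have ma : mean h (cnorm a) = 0.
  apply/eqP; rewrite -normr_le0; apply/ler_addgt0Pr => e /close[d d0 H].
  pose q := Num.max (cnorm a / 2) (cnorm a - d / 2).
  have [q1 q2] : cnorm a / 2 <= q /\ cnorm a - d / 2 <= q by rewrite !le_max !lexx orbT.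
  have q3 : q < cnorm a by rewrite gt_max; apply/andP; split; lra.
  rewrite add0r -[mean h _]subr0 -(@mean_h_inner q); last by lra.
  by apply: H; rewrite ger0_norm; lra.
have [sa|sa|->] := ltgtP s (cnorm a); [by rewrite mean_h_inner// s0 | | by []].
apply/eqP; rewrite -normr_le0; apply/ler_addgt0Pr => e /close[d d0 H].
pose q := Num.min s (cnorm a + d / 2).
have [q1 q2] : q <= s /\ q <= cnorm a + d / 2 by rewrite !ge_min !lexx orbT.
have q3 : cnorm a < q by rewrite lt_min; apply/andP; split; lra.
rewrite add0r (@mean_h_cst ((cnorm a + q) / 2) ((s + r) / 2) s q); try lra.
rewrite -normrN -[- _]add0r -ma.
by apply: H; rewrite ler0_norm; lra.
Qed.

(** That [h] has mean 0 says that [f] may be replaced by the constant [f a] in front of the kernel,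
    which leaves [mean_kernel]. *)
Lemma cauchy_formula s : cnorm a < s < r ->
  mean (fun z => f z * (z / (z - a))) s = complex.Re (f a) * (2 * pi).
Proof.
move=> /andP[as_ sr]; have s0 : 0 < s < r by have := cnorm_ge0 a; lra.
have ne t : circ s t != a.
  by apply: contraTneq as_ => <-; rewrite cnorm_circ ?ltxx// ltW//; case/andP: s0.
rewrite -(mean_kernel (f a) as_); apply/eqP; rewrite -subr_eq0 -meanB.
- rewrite -[X in _ == X](mean_h s0); apply/eqP/eq_Rintegral => t _.
  by rewrite /h (negbTE (ne t)) mulrBl.
- move=> t; apply: real_diff_cont; apply: is_deriveC_real_diff.
  exact: (is_deriveM (df (circ_in t s0)) (is_derive_kernel (ne t))).
- by move=> t; exact: real_cont_kernel.
Qed.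

End point.

(** The Cauchy formulas at [a] and [b] on the circle |z| = r / 2 are subtracted. The kernels differ
    by z (a - b) / ((z - a) (z - b)) with both denominators at least r / 4, whence M (r / 2) (4 /
    r)^2 = 8 M / r. *)
Lemma bounded_punctured_lipschitz a b : 0 < cnorm a < r / 4 -> 0 < cnorm b < r / 4 ->
  complex.Re (f a) - complex.Re (f b) <= 8 * M / r * cnorm (a - b).
Proof.
move=> ar br; have r0 : 0 < r by lra.
have M0 : 0 <= M by apply: le_trans (cnorm_ge0 _) (fM (z := a) _); lra.
have s0 : 0 < r / 2 < r by lra.
have ne c t : cnorm c < r / 4 -> circ (r / 2) t != c.
  by move=> cr; apply: contraTneq cr => <-; rewrite cnorm_circ; lra.
have sr t : 0 < cnorm (circ (r / 2) t : C) < r by rewrite cnorm_circ; lra.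
have [[_ a4] [_ b4]] := (andP ar, andP br).
have cont c t : cnorm c < r / 4 ->
    real_cont (fun z => complex.Re (f z * (z / (z - c)))) (circ (r / 2) t).
  move=> cr; apply: real_diff_cont; apply: is_deriveC_real_diff.
  exact: (is_deriveM (df (sr t)) (is_derive_kernel (ne c t cr))).
rewrite -(ler_pM2r (x := 2 * pi)) ?mulr_gt0 ?pi_gt0// mulrBl.
rewrite -(@cauchy_formula a _ (r / 2)); try lra.
rewrite -(@cauchy_formula b _ (r / 2)); try lra.
rewrite -meanB; [|by move=> t; exact: cont..].
apply: le_trans (ler_norm _) _; apply: mean_le => t.
  apply: real_diff_cont; apply: is_deriveC_real_diff.
  exact: (is_deriveB (is_deriveM (df (sr t)) (is_derive_kernel (ne a t a4)))
   (is_deriveM (df (sr t)) (is_derive_kernel (ne b t b4)))).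
set z := circ _ _.
have zn : cnorm z = r / 2 by rewrite cnorm_circ; lra.
have far c : cnorm c < r / 4 -> r / 4 <= cnorm (z - c).
  by move=> cr; apply: le_trans (cnormB _ _); lra.
have iv c : cnorm c < r / 4 -> (cnorm (z - c))^-1 <= (r / 4)^-1.
  by move=> cr; rewrite lef_pV2 ?far// posrE; [have := far _ cr|]; lra.
have -> : f z * (z / (z - a)) - f z * (z / (z - b)) =
   f z * z * (z - a)^-1 * (z - b)^-1 * (a - b).
  by field; rewrite !subr_eq0 !ne.
rewrite !cnormM !cnormV zn ler_wpM2r ?cnorm_ge0//.
have -> : 8 * M / r = M * (r / 2) * (r / 4)^-1 * (r / 4)^-1.
  by field; rewrite gt_eqF.
have fz := fM (sr t).
apply: ler_pM; rewrite ?invr_ge0 ?mulr_ge0 ?invr_ge0 ?cnorm_ge0 ?iv//; try lra.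
apply: ler_pM; rewrite ?invr_ge0 ?mulr_ge0 ?invr_ge0 ?cnorm_ge0 ?iv//; try lra.
by apply: ler_wpM2r => //; lra.
Qed.

(** Difference quotients are taken along a small positive real increment [t], short enough for
    [a + t] to stay in the punctured disc of radius r / 4. *)
Lemma bounded_punctured_deriv a : 0 < cnorm a < r / 4 ->
  complex.Re (f' a) <= 8 * M / r.
Proof.
move=> ar; apply/ler_addgt0Pr => e e0.
have [|d d0 fd] := is_deriveC_le (df (z := a) _) e0; first lra.
have [t [t0 td tr ta]] : exists t : R, [/\ 0 < t, t < d, t < r / 4 - cnorm a & t < cnorm a].
  exists (Num.min (Num.min (d / 2) ((r / 4 - cnorm a) / 2)) (cnorm a / 2)).
  rewrite !lt_min !gt_min; split; [lra | |  | ]; apply/orP.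
  - by left; apply/orP; left; lra.
  - by left; apply/orP; right; lra.
  - by right; lra.
have tn : cnorm (t%:C : C) = t by rewrite cnorm_real gtr0_norm.
have at_r : 0 < cnorm (a + t%:C) < r / 4.
  have := cnormB a (- t%:C); rewrite cnorm_opp opprK tn.
  by have := cnorm_triangle a t%:C; rewrite tn; lra.
have := fd t%:C; rewrite tn => /(_ td) H.
have := @bounded_punctured_lipschitz _ _ at_r ar.
rewrite [X in cnorm (X - _)]addrC addrK tn => L.
have := le_trans (cnorm_Re _) H; rewrite ler_norml => /andP[+ _].
have -> : complex.Re (f (a + t%:C) - f a - f' a * t%:C) =
   complex.Re (f (a + t%:C)) - complex.Re (f a) - complex.Re (f' a) * t.
  by rewrite !raddfB /=; congr (_ - _); case: (f' a) => x y /=; ring.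
move=> H2; rewrite -(ler_pM2r t0) mulrDl; lra.
Qed.

End cauchy.

(** * The inner product of [ell2] and the Fubini-Study metric *)

Section inner_product.
Variables (R : realType) (I : choiceType).
Local Notation C := R[i].
Local Notation H := (ell2 R I).
Local Notation N := (@ell2_sqnorm R I).
Implicit Types (x y w : H) (c : C).

(* The inner product is obtained from the norm by polarization; this lemma turns
   identities between squared norms into pointwise ones. *)
Lemma ell2_sqnorm_eq3 (s1 s2 s3 t1 t2 t3 : R) (x1 x2 x3 y1 y2 y3 : H) :
  0 <= s1 -> 0 <= s2 -> 0 <= s3 -> 0 <= t1 -> 0 <= t2 -> 0 <= t3 ->
  (forall j, s1 * sqnormc (x1 j) + s2 * sqnormc (x2 j) + s3 * sqnormc (x3 j) =
             t1 * sqnormc (y1 j) + t2 * sqnormc (y2 j) + t3 * sqnormc (y3 j)) ->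
  s1 * N x1 + s2 * N x2 + s3 * N x3 = t1 * N y1 + t2 * N y2 + t3 * N y3.
Proof.
have E (s1' s2' s3' : R) (z1 z2 z3 : H) : 0 <= s1' -> 0 <= s2' -> 0 <= s3' ->
    (s1' * N z1 + s2' * N z2 + s3' * N z3)%:E =
    (\esum_(j in [set: I])
      (s1' * sqnormc (z1 j) + s2' * sqnormc (z2 j) + s3' * sqnormc (z3 j))%:E)%E.
  move=> h1 h2 h3; rewrite !EFinD !EFinM !ell2_sqnormE /ell2_sum -!esumZ//; last 3 first.
  - by move=> j; rewrite lee_fin sqnormc_ge0.
  - by move=> j; rewrite lee_fin sqnormc_ge0.
  - by move=> j; rewrite lee_fin sqnormc_ge0.
  rewrite -!esumD// => j _; rewrite -?EFinM -?EFinD lee_fin ?addr_ge0// mulr_ge0//;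
  exact: sqnormc_ge0.
move=> h1 h2 h3 h4 h5 h6 hj; apply: EFin_inj; rewrite !E//.
by apply: eq_esum => j _; rewrite hj.
Qed.

Lemma ell2_funD x y j : (x + y) j = x j + y j. Proof. by []. Qed.
Lemma ell2_funN x j : (- x) j = - x j. Proof. by []. Qed.
Lemma ell2_funZ c x j : (c *: x) j = c * x j. Proof. by []. Qed.

Lemma ell2_sqnormZ c x : N (c *: x) = sqnormc c * N x.
Proof. by apply: EFin_inj; rewrite EFinM !ell2_sqnormE ell2_sumZ. Qed.

Lemma ell2_sqnormN x : N (- x) = N x.
Proof.
by rewrite -scaleN1r ell2_sqnormZ /sqnormc /= oppr0 expr0n addr0 sqrrN expr1n mul1r.
Qed.

Definition ell2_re x y : R := (N (x + y) - N (x - y)) / 4%:R.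

Lemma ell2_reDl x y w : ell2_re (x + y) w = ell2_re x w + ell2_re y w.
Proof.
(* Negative terms are moved across the equality, because sums in the extended reals are only
   combined with nonnegative coefficients. *)
have := @ell2_sqnorm_eq3 1 1 1 1 1 1
  (x + y + w) (x - w) (y - w) (x + y - w) (x + w) (y + w).
rewrite !ler01 => /(_ isT isT isT isT isT isT).
have E : forall j, 1 * sqnormc ((x + y + w) j) + 1 * sqnormc ((x - w) j) +
   1 * sqnormc ((y - w) j) = 1 * sqnormc ((x + y - w) j) + 1 * sqnormc ((x + w) j) +
   1 * sqnormc ((y + w) j).
  move=> j; rewrite !ell2_funD !ell2_funN.
  by case: (x j) (y j) (w j) => [a b] [a' b'] [a'' b'']; rewrite /sqnormc /=; ring.
move=> /(_ E); rewrite !mul1r /ell2_re.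
have lin (a b c a' b' c' : R) : a + b + c = a' + b' + c' ->
  (a - a') / 4%:R = (b' - b) / 4%:R + (c' - c) / 4%:R by lra.
exact: lin.
Qed.

Lemma ell2_re_sym x y : ell2_re x y = ell2_re y x.
Proof. by rewrite /ell2_re [x + y]addrC -[x - y]opprB ell2_sqnormN. Qed.

Lemma ell2_reNl x y : ell2_re (- x) y = - ell2_re x y.
Proof.
rewrite /ell2_re [- x + y]addrC -[y - x]opprB -opprD !ell2_sqnormN; ring.
Qed.

Lemma ell2_reZl (s : R) x w : ell2_re (s%:C *: x) w = s * ell2_re x w.
Proof.
wlog s0 : s / 0 <= s.
  move=> Hs; have [/Hs//|/ltW s0] := leP 0 s.
  by rewrite -[s]opprK rmorphN scaleNr ell2_reNl Hs ?oppr_ge0// !mulNr.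
have := @ell2_sqnorm_eq3 1 s 0 1 s 0
  (s%:C *: x + w) (x - w) 0 (s%:C *: x - w) (x + w) 0.
rewrite !ler01 s0 lexx => /(_ isT isT isT isT isT isT).
have E : forall j, 1 * sqnormc ((s%:C *: x + w) j) + s * sqnormc ((x - w) j) +
   0 * sqnormc ((0 : H) j) = 1 * sqnormc ((s%:C *: x - w) j) + s * sqnormc ((x + w) j) +
   0 * sqnormc ((0 : H) j).
  move=> j; rewrite !ell2_funD !ell2_funN !ell2_funZ.
  by case: (x j) (w j) => [a b] [a' b']; rewrite /sqnormc /=; ring.
move=> /(_ E); rewrite !mul1r !mul0r /ell2_re.
have lin (a b a' b' : R) : a + s * b + 0 = a' + s * b' + 0 ->
  (a - a') / 4%:R = s * ((b' - b) / 4%:R) by lra.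
exact: lin.
Qed.

Lemma ell2_sqnormD x y : N (x + y) = N x + N y + 2 * ell2_re x y.
Proof.
have := @ell2_sqnorm_eq3 1 1 0 2 2 0 (x + y) (x - y) 0 x y 0.
rewrite !ler01 !ler0n lexx => /(_ isT isT isT isT isT isT).
have E : forall j, 1 * sqnormc ((x + y) j) + 1 * sqnormc ((x - y) j) +
   0 * sqnormc ((0 : H) j) = 2 * sqnormc (x j) + 2 * sqnormc (y j) +
   0 * sqnormc ((0 : H) j).
  move=> j; rewrite !ell2_funD !ell2_funN.
  by case: (x j) (y j) => [a b] [a' b']; rewrite /sqnormc /=; ring.
by move=> /(_ E); rewrite !mul1r !mul0r /ell2_re; lra.
Qed.

Lemma ell2_reii x y : ell2_re ('i *: x) ('i *: y) = ell2_re x y.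
Proof.
by rewrite /ell2_re -scalerDr -scalerBr !ell2_sqnormZ /sqnormc /= expr0n expr1n add0r !mul1r.
Qed.

Lemma ell2_reil x y : ell2_re ('i *: x) y = - ell2_re x ('i *: y).
Proof.
by rewrite -ell2_reii scalerA -expr2 sqr_i scaleN1r ell2_reNl.
Qed.

Lemma ell2_sqnorm_i x : ell2_re x ('i *: x) = 0.
Proof. by have := ell2_reil x x; rewrite ell2_re_sym; lra. Qed.

Lemma ell2_rexx x : ell2_re x x = N x.
Proof.
rewrite /ell2_re subrr -mulr2n -scaler_nat ell2_sqnormZ /sqnormc.
have -> : N 0 = 0.
  by have := ell2_sqnormZ 0 0; rewrite scaler0 /sqnormc /= expr0n addr0 mul0r.
have -> : (2%:R : C) = (2%:R)%:C by rewrite rmorph_nat.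
by rewrite /= expr0n addr0 subr0; field.
Qed.

(* Linear in [x] and conjugate-linear in [y]. *)
Definition ip x y : C := ell2_re x y +i* ell2_re x ('i *: y).

Lemma ipDl x y w : ip (x + y) w = ip x w + ip y w.
Proof. by rewrite /ip !ell2_reDl. Qed.

Lemma ipZl c x w : ip (c *: x) w = c * ip x w.
Proof.
rewrite /ip; case: c => a b.
have -> : (a +i* b) *: x = a%:C *: x + b%:C *: ('i *: x).
  rewrite scalerA -scalerDl; congr (_ *: _).
  by apply/eqP; rewrite eq_complex /=; apply/andP; split; apply/eqP; ring.
rewrite !ell2_reDl !ell2_reZl ell2_reii ell2_reil.
by apply/eqP; rewrite eq_complex /=; apply/andP; split; apply/eqP; ring.
Qed.

Lemma ipNl x w : ip (- x) w = - ip x w.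
Proof. by rewrite -scaleN1r ipZl mulN1r. Qed.

Lemma ipBl x y w : ip (x - y) w = ip x w - ip y w.
Proof. by rewrite ipDl ipNl. Qed.

Lemma ip_conj x y : ip y x = (ip x y)^*%C.
Proof. by rewrite /ip /= [ell2_re y x]ell2_re_sym [ell2_re y _]ell2_re_sym ell2_reil. Qed.

Lemma ipZr c x w : ip w (c *: x) = c^*%C * ip w x.
Proof. by rewrite [LHS]ip_conj ipZl [ip w x]ip_conj; exact: rmorphM. Qed.

Lemma ipBr x y w : ip w (x - y) = ip w x - ip w y.
Proof. by rewrite [LHS]ip_conj ipBl [ip w x]ip_conj [ip w y]ip_conj; exact: rmorphB. Qed.

Lemma ipxx x : ip x x = (N x)%:C.
Proof. by rewrite /ip ell2_rexx ell2_sqnorm_i. Qed.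

Lemma ipE x y : ip x y = ell2_re x y +i* ell2_re x ('i *: y).
Proof. by []. Qed.

Lemma ell2_sqnormB_ip x y c :
  N (x - c *: y) = N x - 2 * complex.Re (c^*%C * ip x y) + sqnormc c * N y.
Proof.
have : complex.Re (ip (x - c *: y) (x - c *: y)) = N (x - c *: y) by rewrite ipxx.
move=> <-; rewrite ipBl !ipBr ipZl !ipZr [ip y x]ip_conj ipZl !ipxx.
case: c => a b; case: (ip x y) => p q; rewrite /sqnormc /=; ring.
Qed.

Lemma ell2_sqnorm_eq0 x : (N x == 0) = (x == 0).
Proof.
apply/eqP/eqP => [x0|->]; last first.
  by rewrite -(scale0r 0) ell2_sqnormZ /sqnormc /= expr0n addr0 mul0r.
by apply: (@ell2_norm0_eq0 R I); rewrite /ell2_norm x0 sqrtr0.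
Qed.

Lemma ell2_sqnorm_gt0 x : (0 < N x) = (x != 0).
Proof. by rewrite lt_neqAle ell2_sqnorm_ge0 andbT eq_sym ell2_sqnorm_eq0. Qed.

Lemma cauchy_schwarz x y : sqnormc (ip x y) <= N x * N y.
Proof.
have [->|y0] := eqVneq y 0.
  by rewrite -(scale0r 0) ipZr conjc0 mul0r ell2_sqnormZ /sqnormc /= expr0n addr0 mul0r mulr0.
have Ny : 0 < N y by rewrite ell2_sqnorm_gt0.
have := ell2_sqnorm_ge0 (x - ((N y)^-1%:C * ip x y) *: y).
rewrite ell2_sqnormB_ip sqnormcM.
have -> : sqnormc (((N y)^-1)%:C : C) = (N y)^-1 ^+ 2 by rewrite /sqnormc /= expr0n addr0.
have -> : complex.Re (((N y)^-1%:C * ip x y)^*%C * ip x y) = (N y)^-1 * sqnormc (ip x y).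
  by case: (ip x y) => p q; rewrite /sqnormc /=; ring.
set S := sqnormc _.
have -> : N x - 2 * ((N y)^-1 * S) + (N y)^-1 ^+ 2 * S * N y = (N x * N y - S) / N y.
  by field; rewrite gt_eqF.
by rewrite pmulr_lge0 ?invr_gt0// subr_ge0.
Qed.

Definition nrm x : R := Num.sqrt (N x).

Lemma nrmE x : `|x| = (nrm x)%:C. Proof. by []. Qed.

Lemma nrm_ge0 x : 0 <= nrm x. Proof. exact: sqrtr_ge0. Qed.

Lemma sqr_nrm x : nrm x ^+ 2 = N x. Proof. exact/sqr_sqrtr/ell2_sqnorm_ge0. Qed.

Lemma nrmZ c x : nrm (c *: x) = cnorm c * nrm x.
Proof.
rewrite /nrm ell2_sqnormZ sqrtrM ?sqnormc_ge0// -sqr_cnorm sqrtr_sqr.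
by rewrite ger0_norm ?cnorm_ge0.
Qed.

Lemma nrmD x y : nrm (x + y) <= nrm x + nrm y.
Proof. by have := ler_normD x y; rewrite !nrmE -rmorphD lecR. Qed.

Lemma cnorm_ip x y : cnorm (ip x y) <= nrm x * nrm y.
Proof.
rewrite -ler_sqr ?nnegrE ?mulr_ge0 ?nrm_ge0 ?cnorm_ge0// exprMn !sqr_nrm sqr_cnorm.
exact: cauchy_schwarz.
Qed.

Definition lift_diff (G : C -> H) (b : C) (V : H) := forall e, 0 < e ->
  exists2 d, 0 < d & forall h, cnorm h < d ->
  nrm (G (b + h) - G b - h *: V) <= e * cnorm h.

Lemma lift_diff_ip G b V v : lift_diff G b V ->
  is_derive b (1 : C) (fun z => ip (G z) v) (ip V v).
Proof.
move=> dG; apply: le_is_deriveC => e e0.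
have v0 := nrm_ge0 v.
have e1 : 0 < e / (nrm v + 1) by rewrite divr_gt0//; lra.
have [d d0 H1] := dG _ e1; exists d => // h hd.
rewrite [_ * h]mulrC -ipZl -!ipBl (le_trans (cnorm_ip _ _))//.
apply: le_trans (ler_wpM2r v0 (H1 _ hd)) _.
rewrite mulrAC ler_wpM2r ?cnorm_ge0// mulrAC ler_pdivrMr; last lra.
by rewrite ler_wpM2l ?ltW//; lra.
Qed.

Lemma lift_diff_sqnorm G b V : lift_diff G b V ->
  real_diff (fun z => N (G z)) b (2 * ip V (G b)).
Proof.
move=> dG e e0; set Z := G b.
have [z0 v0] := (nrm_ge0 Z, nrm_ge0 V).
pose L := 2 * nrm Z + (nrm V + 1) ^+ 2 + 1.
have L0 : 0 < L by have := sqr_ge0 (nrm V + 1); rewrite /L; lra.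
pose e1 := Num.min 1 (e / L).
have [e10 e11 e1L] : [/\ 0 < e1, e1 <= 1 & e1 * L <= e].
  split; first by rewrite lt_min ltr01 divr_gt0.
    by rewrite ge_min lexx.
  by rewrite -ler_pdivlMr// ge_min lexx orbT.
have [d d0 H1] := dG _ e10.
exists (Num.min d e1); first by rewrite lt_min d0.
move=> h; rewrite lt_min => /andP[/H1 hd he]; move: hd.
rewrite -/Z; set Rm := _ - _ - _ => hd.
have -> : G (b + h) = Z + (h *: V + Rm).
  by rewrite addrA addrC /Rm -[G _ - Z - _]addrA -opprD subrK.
rewrite ell2_sqnormD; set W := h *: V + Rm.
have -> : complex.Re (2 * ip V Z * h) = 2 * ell2_re Z (h *: V).
  rewrite -[2 * ip V Z * h]mulrA [ip V Z * h]mulrC -ipZl [ell2_re Z _]ell2_re_sym.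
  have -> : (2 : C) = 2%:C by rewrite rmorph_nat.
  by rewrite ipE /=; ring.
(* What remains is the second-order term in the increment [W] and the pairing of [Z] with the
   remainder [Rm] of [G]; [L] collects their two bounds. *)
have -> : N Z + N W + 2 * ell2_re Z W - N Z - 2 * ell2_re Z (h *: V) =
   N W + 2 * ell2_re Z Rm.
  by rewrite /W [ell2_re Z (_ + _)]ell2_re_sym ell2_reDl !(ell2_re_sym Z); ring.
have h0 := cnorm_ge0 h.
have W1 : nrm W <= (nrm V + 1) * cnorm h.
  apply: le_trans (nrmD _ _) _; rewrite nrmZ.
  have : e1 * cnorm h <= 1 * cnorm h by rewrite ler_wpM2r.
  by move: hd; lra.
have W2 : `|N W| <= (nrm V + 1) ^+ 2 * cnorm h * e1.
  rewrite ger0_norm ?ell2_sqnorm_ge0// -sqr_nrm.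
  apply: le_trans (_ : ((nrm V + 1) * cnorm h) ^+ 2 <= _).
    by rewrite ler_sqr ?nnegrE ?nrm_ge0 ?mulr_ge0//; lra.
  rewrite exprMn -mulrA ler_wpM2l ?sqr_ge0// expr2 ler_wpM2l// ltW//.
have W3 : `|ell2_re Z Rm| <= nrm Z * (e1 * cnorm h).
  have -> : ell2_re Z Rm = complex.Re (ip Z Rm) by [].
  apply: le_trans (cnorm_Re _) _; apply: le_trans (cnorm_ip _ _) _.
  by rewrite ler_wpM2l.
apply: le_trans (ler_normD _ _) _; rewrite normrM (ger0_norm (x := 2))//.
apply: le_trans (_ : e1 * L * cnorm h <= _); last by rewrite ler_wpM2r.
have : 0 <= e1 * cnorm h by rewrite mulr_ge0// ltW.
by rewrite /L; lra.
Qed.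

End inner_product.

(** * The form (i/2)∂∂̄ of a function of a Hermitian squared norm *)

Section kahler_quadratic.
Variables (R : realType) (V : lmodType R[i]).
Variables (q : V -> R) (B : V -> V -> R).
Hypotheses
  (qD : forall p v (t : R), q (p + t%:C *: v) = q p + t * (2 * B p v) + t ^+ 2 * B v v)
  (BD : forall p v w (t : R), B (p + t%:C *: v) w = B p w + t * B v w)
  (BNr : forall p w, B p (- w) = - B p w)
  (Bii : forall v, B ('i *: v) ('i *: v) = B v v)
  (Bvi : forall v, B v ('i *: v) = 0)
  (Biv : forall v, B ('i *: v) v = 0).
Variables (phi phi1 phi2 : R -> R).
Hypotheses
  (dphi : forall x : R, 0 < x -> is_derive x 1 phi (phi1 x))
  (dphi1 : forall x : R, 0 < x -> is_derive x 1 phi1 (phi2 x)).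

Lemma rderive_near (f g : V -> R[i]) v p :
  (\forall t \near (0 : R), f (p + t%:C *: v) = g (p + t%:C *: v)) ->
  rderive f v p = rderive g v p.
Proof.
move=> fg; rewrite /rderive !derive1E; congr (_ +i* _).
  by apply: near_eq_derive; apply: filterS fg => t ->.
by apply: near_eq_derive; apply: filterS fg => t ->.
Qed.

Let dq p v : is_derive (0 : R) 1 (fun t : R => q (p + t%:C *: v)) (2 * B p v).
Proof.
have := @is_derive_quadratic R (fun t => q (p + t%:C *: v)) _ _ _ 0 (qD p v).
by rewrite mulr0 mul0r addr0.
Qed.

Let q0 p v : q (p + (0 : R)%:C *: v) = q p.
Proof. by rewrite scale0r addr0. Qed.

Let drad p v : 0 < q p ->
  is_derive (0 : R) 1 (fun t : R => phi (q (p + t%:C *: v))) (phi1 (q p) * (2 * B p v)).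
Proof.
move=> p0; apply: (@is_derive1_comp _ phi (fun t => q (p + t%:C *: v))); last exact: dq.
by rewrite q0; exact: dphi.
Qed.

Let dB p v w : 0 < q p ->
  is_derive (0 : R) 1 (fun t : R => phi1 (q (p + t%:C *: v)) * B (p + t%:C *: v) w)
  (phi2 (q p) * (2 * B p v) * B p w + phi1 (q p) * B v w).
Proof.
move=> p0.
have d1 : is_derive (0 : R) 1 (fun t : R => phi1 (q (p + t%:C *: v)))
    (phi2 (q p) * (2 * B p v)).
  apply: (@is_derive1_comp _ phi1 (fun t => q (p + t%:C *: v))); last exact: dq.
  by rewrite q0; exact: dphi1.
have d2 : is_derive (0 : R) 1 (fun t : R => B (p + t%:C *: v) w) (B v w).
  have BE t : B (p + t%:C *: v) w = B p w + t * B v w + t ^+ 2 * 0.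
    by rewrite BD mulr0 addr0.
  have := @is_derive_quadratic R (fun t => B (p + t%:C *: v) w) _ _ _ 0 BE.
  by rewrite !mulr0 addr0.
have := is_deriveM d1 d2.
congr is_derive; rewrite /GRing.scale /= q0 BD mul0r addr0; ring.
Qed.

Let half (z : R[i]) : z / 2%:R = (complex.Re z / 2) +i* (complex.Im z / 2).
Proof.
have -> : (2%:R : R[i])^-1 = (2^-1)%:C by rewrite fmorphV rmorph_nat.
by case: z => a b; apply/eqP; rewrite eq_complex /=; apply/andP; split; apply/eqP; ring.
Qed.

Let f := fun z => (phi (q z))%:C.

Let delbarE w p : 0 < q p ->
  delbar f w p = (phi1 (q p) * B p w) +i* (phi1 (q p) * B p ('i *: w)).
Proof.
move=> p0; rewrite /delbar half /rderive /f /=.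
rewrite !derive1E !(@derive_val _ _ _ _ _ _ _ (drad _ p0)) !derive_cst.
by congr (_ +i* _); field.
Qed.

Let q_near p v : 0 < q p -> \forall t \near (0 : R), 0 < q (p + t%:C *: v).
Proof.
move=> p0; have /derivable1_diffP/differentiable_continuous := @ex_derive _ _ _ _ _ _ _ (dq p v).
by move=> /(cvgr_gt _); apply; rewrite q0.
Qed.

Let rderive_delbar w v p : 0 < q p ->
  rderive (delbar f w) v p =
  (phi2 (q p) * (2 * B p v) * B p w + phi1 (q p) * B v w) +i*
  (phi2 (q p) * (2 * B p v) * B p ('i *: w) + phi1 (q p) * B v ('i *: w)).
Proof.
move=> p0; rewrite (@rderive_near _
    (fun z => (phi1 (q z) * B z w) +i* (phi1 (q z) * B z ('i *: w)))).
  by rewrite /rderive /= !derive1E !(@derive_val _ _ _ _ _ _ _ (dB _ _ p0)).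
by apply: filterS (q_near v p0) => t qt; rewrite delbarE.
Qed.

(** One computation serves both metrics: phi = ln gives the Fubini-Study metric, and phi = sqrt / 2
    with q = |z|^2 gives the cone. *)
Lemma kahler_form_quadratic p v : 0 < q p ->
  kahler_form (phi \o q) p v ('i *: v) =
  (phi2 (q p) * (B p v ^+ 2 + B p ('i *: v) ^+ 2) + phi1 (q p) * B v v)%:C.
Proof.
move=> p0; rewrite /kahler_form /ddbar -/f /del !rderive_delbar//.
have ii w : 'i *: ('i *: w) = - w :> V by rewrite scalerA -expr2 sqr_i scaleN1r.
have BNl w w' : B (- w) w' = - B w w'.
  have -> : - w = w + (- 2%:R)%:C *: w; last by rewrite BD; ring.
  rewrite -[w in w + _]scale1r -scalerDl -scaleN1r; congr (_ *: _).
  by apply/eqP; rewrite eq_complex /=; apply/andP; split; apply/eqP; ring.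
rewrite !ii !BNr !BNl !Bii !Bvi !Biv !half.
by apply/eqP; rewrite eq_complex /=; apply/andP; split; apply/eqP; field.
Qed.

End kahler_quadratic.

Section fubini_study_formula.
Variables (R : realType) (I : choiceType).

Lemma fubini_studyE (Z W : ell2 R I) : Z != 0 ->
  fubini_study Z W W =
  (ell2_sqnorm W * ell2_sqnorm Z - sqnormc (ip W Z)) / ell2_sqnorm Z ^+ 2.
Proof.
rewrite -ell2_sqnorm_gt0 => Z0.
have dln (x : R) : 0 < x -> is_derive x 1 (@ln R) x^-1 by move=> x0; exact: is_derive1_ln.
have dinv (x : R) : 0 < x -> is_derive x 1 (fun x : R => x^-1) (- x ^- 2).
  move=> x0; have := @is_derive_inv R id x 1 1 (lt0r_neq0 x0) (is_derive_id x 1).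
  by congr is_derive; rewrite /GRing.scale /= mulr1.
rewrite /fubini_study.
rewrite (@kahler_form_quadratic R _ (@ell2_sqnorm R I) (@ell2_re R I)
  _ _ _ _ _ _ _ _ _ dln dinv Z W Z0) /=.
- rewrite ell2_rexx ip_conj /sqnormc /=; field; exact: lt0r_neq0.
- move=> p v t; rewrite ell2_sqnormD ell2_sqnormZ [ell2_re p _]ell2_re_sym ell2_reZl.
  by rewrite ell2_rexx [ell2_re v p]ell2_re_sym /sqnormc /=; ring.
- by move=> p v w t; rewrite ell2_reDl ell2_reZl.
- by move=> p w; rewrite ell2_re_sym ell2_reNl ell2_re_sym.
- by move=> v; exact: ell2_reii.
- by move=> v; exact: ell2_sqnorm_i.
- by move=> v; rewrite ell2_re_sym; exact: ell2_sqnorm_i.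
Qed.

End fubini_study_formula.

(** * The flat cone metric on a complex line *)

Section cone.
Variables (R : realType).
Local Notation C := R[i].

(** Each Wirtinger derivative in the direction [v] uses only the real directions [v] and ['i *: v],
    so it commutes with restriction to a complex line, without any regularity of [phi]. *)
Lemma kahler_form_line (V : lmodType C) (phi : V -> R) (e : V) (b v w : C) :
  kahler_form phi (b *: e) (v *: e) (w *: e) =
  kahler_form (fun z : C^o => phi (z *: e)) (b : C^o) (v : C^o) (w : C^o).
Proof.
have rd (f : V -> C) (v' z : C) : rderive f (v' *: e) (z *: e) =
    rderive (fun z : C^o => f (z *: e)) (v' : C^o) (z : C^o).
  have E (t : R) : z *: e + t%:C *: (v' *: e) = ((z : C^o) + t%:C *: (v' : C^o)) *: e.
    by rewrite scalerA -scalerDl.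
  by rewrite /rderive; congr (derive1 _ _ +i* derive1 _ _); apply/funext => t; rewrite E.
have rdi (f : V -> C) (v' z : C) : rderive f ('i *: (v' *: e)) (z *: e) =
    rderive (fun z : C^o => f (z *: e)) ('i *: (v' : C^o)) (z : C^o).
  by rewrite scalerA rd.
have db (f : V -> C) (v' z : C) : delbar f (v' *: e) (z *: e) =
    delbar (fun z : C^o => f (z *: e)) (v' : C^o) (z : C^o).
  by rewrite /delbar rd rdi.
have dl (f : V -> C) (v' z : C) : del f (v' *: e) (z *: e) =
    del (fun z : C^o => f (z *: e)) (v' : C^o) (z : C^o).
  by rewrite /del rd rdi.
pose F z := (phi z)%:C; pose G (z : C^o) := (phi (z *: e))%:C.
have key (x y : C) : del (delbar F (x *: e)) (y *: e) (b *: e) =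
    del (delbar G (x : C^o)) (y : C^o) (b : C^o).
  have E : (fun z : C^o => delbar F (x *: e) (z *: e)) = delbar G (x : C^o).
    by apply/funext => z; exact: (db F x z).
  by rewrite -E; exact: (dl (delbar F (x *: e)) y b).
rewrite /kahler_form /ddbar -/F -/G.
by rewrite (key w v) (key v w).
Qed.

(** The arguments are of the form v, i v with v = -i. With phi = sqrt / 2 at x = |b|^2, the two
    terms are - 1 / (8 |b|) and 1 / (4 |b|). *)
Lemma kahler_form_half_norm (b : C) : b != 0 ->
  kahler_form (fun z : C^o => cnorm z / 2) (b : C^o) (- 'i : C^o) (1 : C^o) =
  ((8 * cnorm b)^-1)%:C.
Proof.
move=> b0; have n0 : 0 < sqnormc b by rewrite lt_neqAle sqnormc_ge0 andbT eq_sym sqnormc_eq0.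
have d1 (x : R) : 0 < x -> is_derive x 1 (fun x => Num.sqrt x / 2) (4 * Num.sqrt x)^-1.
  move=> x0; have := is_deriveM (is_derive1_sqrt x0) (is_derive_cst (2^-1 : R) x 1).
  congr is_derive; rewrite /GRing.scale /=.
  by have s0 : Num.sqrt x != 0; [rewrite gt_eqF// sqrtr_gt0 | field].
have d2 (x : R) : 0 < x ->
    is_derive x 1 (fun x => (4 * Num.sqrt x)^-1) (- (8 * x * Num.sqrt x)^-1).
  move=> x0; have s0 : 0 < Num.sqrt x by rewrite sqrtr_gt0.
  have s4 : 4 * Num.sqrt x != 0 by rewrite gt_eqF// mulr_gt0.
  have := @is_derive_inv R (fun x => 4 * Num.sqrt x) x _ 1 s4
    (is_deriveZ 4 (is_derive1_sqrt x0)).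
  congr is_derive; rewrite /GRing.scale /=.
  move: (sqr_sqrtr (ltW x0)) s0; move: (Num.sqrt x) => s <- s0.
  by field; rewrite gt_eqF.
have -> : (1 : C^o) = 'i *: (- 'i : C^o).
  by rewrite /GRing.scale /= mulrN -expr2 sqr_i opprK.
have -> : (fun z : C^o => cnorm z / 2) = (fun x => Num.sqrt x / 2) \o (@sqnormc R).
  by apply/funext => z /=; rewrite -sqr_cnorm sqrtr_sqr ger0_norm ?cnorm_ge0.
pose B (z w : C) := complex.Re z * complex.Re w + complex.Im z * complex.Im w.
rewrite (@kahler_form_quadratic R C^o (@sqnormc R) B _ _ _ _ _ _ _ _ _ d1 d2 b _ n0).
- congr _%:C; rewrite -(sqr_cnorm b) sqrtr_sqr ger0_norm ?cnorm_ge0//.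
  have -> : B b (- 'i) ^+ 2 + B b ('i *: (- 'i : C^o)) ^+ 2 = cnorm b ^+ 2.
    by rewrite sqr_cnorm; case: (b) => x y; rewrite /B /sqnormc /GRing.scale /=; ring.
  have -> : B (- 'i) (- 'i) = 1 by rewrite /B /=; ring.
  by field; rewrite gt_eqF// cnorm_gt0.
- by move=> [p1 p2] [v1 v2] t; rewrite /B /sqnormc /GRing.scale /=; ring.
- by move=> [p1 p2] [v1 v2] [w1 w2] t; rewrite /B /sqnormc /GRing.scale /=; ring.
- by move=> [p1 p2] [v1 v2]; rewrite /B /=; ring.
- by move=> [p1 p2]; rewrite /B /GRing.scale /=; ring.
- by move=> [p1 p2]; rewrite /B /GRing.scale /=; ring.
- by move=> [p1 p2]; rewrite /B /GRing.scale /=; ring.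
Qed.

End cone.

(** * The chart of the Kepler manifold *)

Lemma differentiable_rV (K : numFieldType) (V : normedModType K) (m : nat)
    (F : V -> 'rV[K]_m.+1) (x : V) :
  (forall j, differentiable (fun y => F y 0 j) x) -> differentiable F x.
Proof.
move=> dF.
have -> : F = (\sum_(j < m.+1) (fun y => F y 0 j *: (delta_mx 0 j : 'rV[K]_m.+1)))%R.
  by apply/funext => y; rewrite fct_sumE {1}[F y]row_sum_delta.
by apply: differentiable_sum => j; exact/differentiableZl.
Qed.

Section chart.
Variables (R : realType) (k : nat).
Local Notation C := R[i].

(* In the coordinates [a = z_0 + i z_1] and [b = z_0 - i z_1] the quadric reads
   [a b = - (z_2 ^ 2 + ... + z_(k+1) ^ 2)], which is solved for [a] where
   [b <> 0]; the remaining coordinates of [u] are [z_2, ..., z_(k+1)]. *)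
Definition conull_coord (u : 'rV[C]_k.+1) : C :=
  - (\sum_(j < k) u 0 (lift ord0 j) ^+ 2) / u 0 ord0.

Definition kepler_param (u : 'rV[C]_k.+1) : 'rV[C]_k.+2 :=
  \row_i oapp (fun i' => oapp (fun j => u 0 (lift ord0 j))
      (- 'i * (conull_coord u - u 0 ord0) / 2) (unlift ord0 i'))
    ((conull_coord u + u 0 ord0) / 2) (unlift ord0 i).

Definition kepler_chart (z : 'rV[C]_k.+2) : 'rV[C]_k.+1 :=
  \row_i oapp (fun j => z 0 (lift ord0 (lift ord0 j)))
    (z 0 ord0 - 'i * z 0 (lift ord0 ord0)) (unlift ord0 i).

Lemma kepler_param0 u : kepler_param u 0 ord0 = (conull_coord u + u 0 ord0) / 2.
Proof. by rewrite mxE unlift_none. Qed.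

Lemma kepler_param1 u :
  kepler_param u 0 (lift ord0 ord0) = - 'i * (conull_coord u - u 0 ord0) / 2.
Proof. by rewrite mxE liftK /= unlift_none. Qed.

Lemma kepler_param2 u j : kepler_param u 0 (lift ord0 (lift ord0 j)) = u 0 (lift ord0 j).
Proof. by rewrite mxE liftK /= liftK. Qed.

Lemma kepler_chart0 z : kepler_chart z 0 ord0 = z 0 ord0 - 'i * z 0 (lift ord0 ord0).
Proof. by rewrite mxE unlift_none. Qed.

Lemma kepler_chart1 z j : kepler_chart z 0 (lift ord0 j) = z 0 (lift ord0 (lift ord0 j)).
Proof. by rewrite mxE liftK. Qed.

Lemma differentiable_conull_coord (u : 'rV[C]_k.+1) :
  u 0 ord0 != 0 -> differentiable conull_coord u.
Proof.
move=> u0.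
have dc i : differentiable (fun u : 'rV[C]_k.+1 => u 0 i) u by exact: differentiable_coord.
pose sq : 'rV[C]_k.+1 -> C :=
  (\sum_(j < k) (fun u : 'rV[C]_k.+1 => u 0 (lift ord0 j) * u 0 (lift ord0 j)))%R.
have ds : differentiable sq u.
  by apply: differentiable_sum => j; apply: differentiableM.
have -> : conull_coord = (- sq * (fun u => (u 0 ord0)^-1))%R.
  apply/funext => v; rewrite /conull_coord /= fctE /= fctE /sq fct_sumE.
  by congr (- _ / _); apply: eq_bigr => j _; rewrite expr2.
apply: differentiableM; first exact: differentiableN.
by apply: differentiableV.
Qed.

Lemma differentiable_kepler_param (u : 'rV[C]_k.+1) :
  u 0 ord0 != 0 -> differentiable kepler_param u.
Proof.
move=> u0; have dl := differentiable_conull_coord u0.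
have dc i : differentiable (fun u : 'rV[C]_k.+1 => u 0 i) u by exact: differentiable_coord.
apply: differentiable_rV => i; have [i' ->|->] := unliftP ord0 i; last first.
  have -> : (fun v => kepler_param v 0 ord0) =
      (2^-1 : C) *: (conull_coord + (fun v => v 0 ord0)).
    by apply/funext => v; rewrite kepler_param0 mulrC.
  exact: differentiableZ (differentiableD dl (dc ord0)).
have [j ->|->] := unliftP ord0 i'.
  by under eq_fun do rewrite kepler_param2.
have -> : (fun v => kepler_param v 0 (lift ord0 ord0)) =
    (- 'i / 2 : C) *: (conull_coord - (fun v => v 0 ord0)).
  by apply/funext => v; rewrite kepler_param1 mulrAC.
exact: differentiableZ (differentiableB dl (dc ord0)).
Qed.

Lemma differentiable_kepler_chart (z : 'rV[C]_k.+2) : differentiable kepler_chart z.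
Proof.
have dc i : differentiable (fun u : 'rV[C]_k.+2 => u 0 i) z by exact: differentiable_coord.
apply: differentiable_rV => i; have [j ->|->] := unliftP ord0 i.
  by under eq_fun do rewrite kepler_chart1.
have -> : (fun v => kepler_chart v 0 ord0) =
    ((fun v => v 0 ord0) - ('i : C) *: (fun v => v 0 (lift ord0 ord0))).
  by apply/funext => v; rewrite kepler_chart0.
exact: differentiableB (dc ord0) (differentiableZ 'i (dc (lift ord0 ord0))).
Qed.

Lemma open_neq0 (T : topologicalType) (f : T -> C) : continuous f ->
  open [set x | f x != 0].
Proof.
move=> cf; apply: (@open_comp _ _ f [set x | x != 0]); first by move=> x _; exact: cf.
rewrite (_ : [set x | x != 0] = ~` [set (0 : C)]); last first.
  by apply/seteqP; split => x /= /eqP.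
apply: closed_openC.
exact: (accessible_closed_set1 (hausdorff_accessible (@norm_hausdorff _ _))).
Qed.

Lemma kepler_holomorphic_chart :
  holomorphic_chart (kepler R k.+1) [set z | z 0 ord0 - 'i * z 0 (lift ord0 ord0) != 0]
    kepler_chart [set u | u 0 ord0 != 0] kepler_param.
Proof.
split.
- apply: open_neq0 => z.
  have dc i : differentiable (fun u : 'rV[C]_k.+2 => u 0 i) z by exact: differentiable_coord.
  exact: differentiable_continuous
    (differentiableB (dc ord0) (differentiableZ 'i (dc (lift ord0 ord0)))).
- by apply: open_neq0 => u; exact/differentiable_continuous/differentiable_coord.
- by move=> z _; exact: differentiable_kepler_chart.
- by move=> u; exact: differentiable_kepler_param.
split.
- move=> z [z0 zq] /= zA; rewrite kepler_chart0; split => //.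
  (* On the quadric the numerator of [conull_coord] is z_0^2 + z_1^2 = (z_0 + i z_1) (z_0 - i z_1),
     and the second factor is nonzero here. *)
  have lE : conull_coord (kepler_chart z) = z 0 ord0 + 'i * z 0 (lift ord0 ord0).
    rewrite /conull_coord kepler_chart0; apply: (mulIf zA); rewrite divfK//.
    have -> : \sum_(j < k) kepler_chart z 0 (lift ord0 j) ^+ 2 =
       - z 0 ord0 ^+ 2 - z 0 (lift ord0 ord0) ^+ 2.
      under eq_bigr do rewrite kepler_chart1.
      move: zq; rewrite !big_ord_recl addrA => /eqP; rewrite addrC addr_eq0 => /eqP ->.
      by rewrite opprD.
    transitivity (z 0 ord0 ^+ 2 - 'i ^+ 2 * z 0 (lift ord0 ord0) ^+ 2).
      by rewrite sqr_i; ring.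
    by ring.
  have := sqr_i R => i2.
  apply/rowP => i; have [i' ->|->] := unliftP ord0 i.
    have [j ->|->] := unliftP ord0 i'; first by rewrite kepler_param2 kepler_chart1.
    rewrite kepler_param1 lE kepler_chart0.
    have -> : - 'i * (z 0 ord0 + 'i * z 0 (lift ord0 ord0) -
         (z 0 ord0 - 'i * z 0 (lift ord0 ord0))) / 2
       = - 'i ^+ 2 * z 0 (lift ord0 ord0) :> C by field.
    by rewrite i2 opprK mul1r.
  by rewrite kepler_param0 lE kepler_chart0; field.
- move=> u /= u0; have i2 := sqr_i R.
  have E : kepler_param u 0 ord0 - 'i * kepler_param u 0 (lift ord0 ord0) = u 0 ord0.
    rewrite kepler_param0 kepler_param1.
    have -> : (conull_coord u + u 0 ord0) / 2 - 'i * (- 'i * (conull_coord u - u 0 ord0) / 2) =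
      (conull_coord u * (1 + 'i ^+ 2) + u 0 ord0 * (1 - 'i ^+ 2)) / 2 :> C by field.
    by rewrite i2; field.
  split; last 1 first.
  + apply/rowP => i; have [j ->|->] := unliftP ord0 i.
      by rewrite kepler_chart1 kepler_param2.
    by rewrite kepler_chart0.
  + split.
      apply/eqP => g0; case/eqP: u0; rewrite -E.
      have gi i : kepler_param u 0 i = 0 by exact: (congr1 (fun f => f 0 i) g0).
      by rewrite !gi mulr0 subr0.
    rewrite !big_ord_recl addrA.
    under eq_bigr do rewrite kepler_param2.
    rewrite kepler_param0 kepler_param1.
    have -> : ((conull_coord u + u 0 ord0) / 2) ^+ 2 +
        (- 'i * (conull_coord u - u 0 ord0) / 2) ^+ 2 =
      conull_coord u * u 0 ord0 :> C.
      transitivity (((conull_coord u + u 0 ord0) ^+ 2 +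
          'i ^+ 2 * (conull_coord u - u 0 ord0) ^+ 2) / 4 : C).
        by field.
      by rewrite i2; field.
    by rewrite /conull_coord divfK// addNr.
  + by rewrite E.
Qed.

(** On this line [conull_coord] vanishes and the point is (z/2) (1, i, 0, ..., 0), whose imaginary
    parts are Im z / 2 and Re z / 2. *)
Lemma norm_im_kepler_param (z : C) :
  norm_im (kepler_param (z *: (delta_mx 0 ord0 : 'rV[C]_k.+1))) = cnorm z / 2.
Proof.
set u := _ *: _.
have u0 : u 0 ord0 = z by rewrite !mxE !eqxx mulr1.
have uj j : u 0 (lift ord0 j) = 0 by rewrite !mxE eqxx /= mulr0.
have l0 : conull_coord u = 0.
  by rewrite /conull_coord big1 ?oppr0 ?mul0r// => j _; rewrite uj expr0n.
rewrite /norm_im !big_ord_recl big1 ?addr0 => [|j _]; last first.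
  by rewrite kepler_param2 uj /= expr0n.
rewrite kepler_param0 kepler_param1 l0 u0 add0r sub0r.
have -> : - 'i * - z / 2 = 'i * z / 2 by rewrite mulrNN.
rewrite -[RHS]ger0_norm ?divr_ge0 ?cnorm_ge0// -sqrtr_sqr exprMn sqr_cnorm.
congr Num.sqrt.
have -> : (2 : C)^-1 = (2^-1)%:C by rewrite fmorphV rmorph_nat.
by case: z {u u0 uj l0} => x y; rewrite /sqnormc /=; field.
Qed.

End chart.

(** * Isometries of the cone into projective space *)

Section cone_curve.
Variables (R : realType) (I : choiceType).
Local Notation C := R[i].
Local Notation H := (ell2 R I).
Local Notation N := (@ell2_sqnorm R I).

(* [Psi] has local lifts [G] to [ell2], complex differentiable at [b], and pulls
   the Fubini-Study metric back to |db|^2 / (8 |b|). *)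
Definition cone_isometry (Psi : C -> CP R I) := forall b : C, b != 0 ->
  exists (G : C -> H) (V : H),
  [/\ exists2 d, 0 < d & forall h, cnorm h < d ->
        sval (Psi (b + h)) (G (b + h)) /\ G (b + h) != 0,
      lift_diff G b V &
      N V * N (G b) - sqnormc (ip V (G b)) = N (G b) ^+ 2 / (8 * cnorm b)].

Variable Psi : C -> CP R I.
Hypothesis lifts : cone_isometry Psi.

(** The choice has no regularity in [b]. Apart from fixing the base vector, it only enters
    expressions invariant under rescaling, which are then differentiated through a local lift. *)
Definition rep (b : C) : H := s2val (cid2 (svalP (Psi b))).

Lemma rep_neq0 b : rep b != 0.
Proof. by rewrite /rep; case: (cid2 _). Qed.

Lemma repP b Z : sval (Psi b) Z -> exists c, Z = c *: rep b.
Proof. by rewrite /rep; case: (cid2 _) => /= W _ -> [c _ <-]; exists c. Qed.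

Section base.
Variable Z0 : H.
Hypothesis Z01 : N Z0 = 1.

(* The squared cosine of the Fubini-Study distance between the lines of [Z] and [Z0]. *)
Definition overlap (Z : H) : R := sqnormc (ip Z Z0) / N Z.

Lemma overlapZ c Z : c != 0 -> overlap (c *: Z) = overlap Z.
Proof.
move=> c0; rewrite /overlap ipZl sqnormcM ell2_sqnormZ.
have s0 : sqnormc c != 0 by rewrite sqnormc_eq0.
by have [->|z0] := eqVneq (N Z) 0; [rewrite mulr0 !invr0 !mulr0 | field; rewrite s0 z0].
Qed.

Lemma overlap_rep b Z : sval (Psi b) Z -> Z != 0 -> overlap (rep b) = overlap Z.
Proof.
by move=> /repP[c ->]; rewrite scaler_eq0 negb_or => /andP[c0 _]; rewrite overlapZ.
Qed.

(** The left side is the square of the derivative of the overlap when Z moves with velocity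
    [c *: V]. The component of V along Z only rescales Z, so V may be replaced by its part W
    orthogonal to Z, of squared norm N Z times [rho]; Cauchy-Schwarz against the unit vector [Z0]
    concludes. *)
Lemma overlap_deriv_bound (Z V : H) (c : C) (rho : R) : Z != 0 ->
  N V * N Z - sqnormc (ip V Z) = N Z ^+ 2 * rho ->
  (2 * complex.Re ((ip Z Z0)^*%C * (ip V Z0 * c)) / N Z
   - sqnormc (ip Z Z0) * (2 * complex.Re (ip V Z * c)) / N Z ^+ 2) ^+ 2 <=
  4 * rho * sqnormc c.
Proof.
rewrite -ell2_sqnorm_gt0 => n0 E.
set n := N Z in n0 E *; set P := ip Z Z0; set s := ip V Z in E *.
pose W := V - (n^-1%:C * s) *: Z.
have NW : N W = n * rho.
  rewrite /W ell2_sqnormB_ip -/n -/s sqnormcM.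
  have -> : sqnormc (n^-1%:C : C) = n^-1 ^+ 2 by rewrite /sqnormc /= expr0n addr0.
  have -> : complex.Re ((n^-1%:C * s)^*%C * s) = n^-1 * sqnormc s.
    by case: (s) => a b; rewrite /sqnormc /=; ring.
  have -> : n * rho = (N V * n - sqnormc s) / n by rewrite E; field; rewrite gt_eqF.
  by field; rewrite gt_eqF.
have -> : 2 * complex.Re (P^*%C * (ip V Z0 * c)) / n
   - sqnormc P * (2 * complex.Re (s * c)) / n ^+ 2 =
   2 * complex.Re (P^*%C * (ip W Z0 * c)) / n.
  rewrite /W ipBl ipZl -/P.
  case: (P) (ip V Z0) (s) (c) => [p1 p2] [v1 v2] [s1 s2] [c1 c2].
  by rewrite /sqnormc /=; field; rewrite gt_eqF.
have P1 : sqnormc P <= n by have := cauchy_schwarz Z Z0; rewrite Z01 mulr1.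
have W1 : sqnormc (ip W Z0) <= n * rho by have := cauchy_schwarz W Z0; rewrite Z01 mulr1 NW.
have -> : 4 * rho * sqnormc c = 4 * (n * (n * rho * sqnormc c)) / n ^+ 2.
  by field; rewrite gt_eqF.
set X := complex.Re _.
have -> : (2 * X / n) ^+ 2 = 4 * X ^+ 2 / n ^+ 2 by field; rewrite gt_eqF.
rewrite ler_wpM2r ?invr_ge0 ?sqr_ge0// ler_wpM2l// /X.
rewrite -real_normK ?num_real//.
apply: le_trans (_ : cnorm (P^*%C * (ip W Z0 * c)) ^+ 2 <= _).
  by rewrite ler_sqr ?nnegrE ?cnorm_ge0// cnorm_Re.
have -> : cnorm (P^*%C * (ip W Z0 * c)) ^+ 2 = sqnormc P * (sqnormc (ip W Z0) * sqnormc c).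
  by rewrite sqr_cnorm !sqnormcM; congr (_ * _); case: (P) => a b; rewrite /sqnormc /= sqrrN.
by rewrite ler_pM ?mulr_ge0 ?sqnormc_ge0// ler_wpM2r ?sqnormc_ge0.
Qed.

Lemma overlap_curve (x y : R -> R) (t x' y' : R) :
  is_derive t 1 x x' -> is_derive t 1 y y' -> x t +i* y t != 0 ->
  exists2 D, is_derive t 1 (fun s => overlap (rep (x s +i* y s))) D &
    D ^+ 2 <= (x' ^+ 2 + y' ^+ 2) / (2 * cnorm (x t +i* y t)).
Proof.
move=> dx dy b0; set b := _ +i* _ in b0 *.
have [G [V [[d d0 Gd] dG E]]] := lifts b0.
have Gb : G b != 0 by have [|_] := Gd 0; rewrite ?cnorm0 ?addr0.
set c := x' +i* y'.
have c1 : real_diff (fun z => complex.Re (ip (G z) Z0)) b (ip V Z0).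
  exact/is_deriveC_real_diff/lift_diff_ip.
(* This is the imaginary part of the pairing, so that the numerator of the overlap is a sum of
   squares of two differentiable functions. *)
have c2 : real_diff (fun z => complex.Re (- 'i * ip (G z) Z0)) b (- 'i * ip V Z0).
  apply: is_deriveC_real_diff.
  exact: (is_deriveZ (- 'i) (lift_diff_ip Z0 dG)).
have c3 : real_diff (fun z => N (G z)) b (2%:C * ip V (G b)).
  by rewrite rmorph_nat; exact: lift_diff_sqnorm.
have d1 := real_diff_curve dx dy c1.
have d2 := real_diff_curve dx dy c2.
have d3 := real_diff_curve dx dy c3.
have n0 : N (G b) != 0 by rewrite ell2_sqnorm_eq0.
have d4 := is_derive_inv (n0 : (fun s => N (G (x s +i* y s))) t != 0) d3.
have d5 := is_deriveM (is_deriveD (is_deriveX 2 d1) (is_deriveX 2 d2)) d4.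
eexists.
  apply: near_eq_is_derive d5.
  have cx : {for t, continuous x}.
    by apply/differentiable_continuous/derivable1_diffP; exact: ex_derive.
  have cy : {for t, continuous y}.
    by apply/differentiable_continuous/derivable1_diffP; exact: ex_derive.
  have d20 : 0 < d / 2 by rewrite divr_gt0.
  near=> s.
  have sd : cnorm ((x s - x t) +i* (y s - y t)) < d.
    apply: le_lt_trans (cnorm_le _) _ => /=.
    have : `|x t - x s| < d / 2 by near: s; move/cvgrPdist_lt : cx; exact.
    have : `|y t - y s| < d / 2 by near: s; move/cvgrPdist_lt : cy; exact.
    by rewrite [`|x t - _|]distrC [`|y t - _|]distrC; lra.
  have sE : b + ((x s - x t) +i* (y s - y t)) = x s +i* y s.
    by apply/eqP; rewrite eq_complex /=; apply/andP; split; apply/eqP; ring.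
  have [Gs1 Gs2] := Gd _ sd; rewrite sE in Gs1 Gs2.
  rewrite (overlap_rep Gs1 Gs2) /overlap; congr (_ / _).
  by rewrite !fctE; move: (ip (G _) Z0) => [p q]; rewrite /sqnormc /=; ring.
have := @overlap_deriv_bound (G b) V c (8 * cnorm b)^-1 Gb E.
have -> : 4 * (8 * cnorm b)^-1 * sqnormc c = (x' ^+ 2 + y' ^+ 2) / (2 * cnorm b).
  have nb : cnorm b != 0 by rewrite cnorm_eq0.
  have -> : sqnormc c = x' ^+ 2 + y' ^+ 2 by [].
  by field.
apply: le_trans; rewrite le_eqVlt; apply/orP; left; apply/eqP; congr (_ ^+ 2).
rewrite /GRing.scale !fctE -/b -/c.
move: n0; move: (ip (G b) Z0) (ip V Z0) (ip V (G b)) (N (G b)) => [p1 p2] [v1 v2] [s1 s2] n n0.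
by rewrite /sqnormc /c /=; field.
Unshelve. all: by end_near. Qed.

(* In the coordinate [w] with [b = w ^ 2] the metric is [|dw|^2 / 2]; a segment in
   the half-plane [0 <= Re w] is followed from the base point [8^-1]. *)
Lemma overlap_near_base (w : C) : Z0 = ((nrm (rep (8^-2)%:C))^-1)%:C *: rep (8^-2)%:C ->
  w != 0 -> cnorm w <= 8^-1 -> 0 <= complex.Re w -> 2^-1 <= overlap (rep (w ^+ 2)).
Proof.
case: w => a b Z0E w0 wn /= a0.
pose u (t : R) : R := 8^-1 + t * (a - 8^-1).
pose x (t : R) : R := u t ^+ 2 - (t * b) ^+ 2.
pose y (t : R) : R := 2 * (u t * (t * b)).
pose x' (t : R) : R := 2 * u t * (a - 8^-1) - 2 * (t * b) * b.
pose y' (t : R) : R := 2 * ((a - 8^-1) * (t * b) + u t * b).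
have dx (t : R) : is_derive t 1 x (x' t).
  have := @is_derive_quadratic R x (8^-1 ^+ 2) (2 * 8^-1 * (a - 8^-1))
    ((a - 8^-1) ^+ 2 - b ^+ 2) t.
  have -> : x' t = 2 * 8^-1 * (a - 8^-1) + 2 * t * ((a - 8^-1) ^+ 2 - b ^+ 2).
    by rewrite /x' /u; ring.
  by apply=> s; rewrite /x /u; ring.
have dy (t : R) : is_derive t 1 y (y' t).
  have := @is_derive_quadratic R y 0 (2 * (8^-1 * b)) (2 * ((a - 8^-1) * b)) t.
  have -> : y' t = 2 * (8^-1 * b) + 2 * t * (2 * ((a - 8^-1) * b)).
    by rewrite /y' /u; ring.
  by apply=> s; rewrite /y /u; ring.
have cE (t : R) : x t +i* y t = (u t +i* (t * b)) ^+ 2.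
  by rewrite expr2; simpc; rewrite /x /y; congr (_ +i* _); ring.
(* The half-plane condition is used here: the real part of the segment is positive for t < 1, and
   its end point w is nonzero. *)
have ne0 (t : R) : 0 <= t <= 1 -> u t +i* (t * b) != 0.
  move=> /andP[t0 t1]; rewrite eq_complex /=; apply/negP => /andP[/eqP u0 /eqP tb].
  have ut : (1 - t) / 8 + t * a = 0 by rewrite -u0 /u; field.
  have h1 : 0 <= t * a by rewrite mulr_ge0.
  have t1' : t = 1 by lra.
  move: w0; rewrite eq_complex /=; move: tb ut; rewrite t1' !mul1r subrr mul0r add0r => -> ->.
  by rewrite eqxx.
have D (t : R) (ht : 0 <= t <= 1) := @overlap_curve x y t _ _ (dx t) (dy t)
   (eq_ind_r (fun z => z != 0) (expf_neq0 2 (ne0 t ht)) (cE t)).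
pose f (t : R) : R := overlap (rep (x t +i* y t)).
pose D' (t : R) : R := derive1 f t.
have dD (t : R) : 0 <= t <= 1 -> is_derive t 1 f (D' t) /\ `|D' t| <= 2^-1.
  move=> ht; have [E dE E2] := D t ht.
  have DE : D' t = E by rewrite /D' derive1E; exact: (@derive_val _ _ _ _ _ _ _ dE).
  rewrite DE; split => //.
  rewrite -ler_sqr ?nnegrE ?invr_ge0// real_normK ?num_real//.
  apply: le_trans E2 _.
  set wt := u t +i* (t * b) in ne0 *.
  have nw : 0 < sqnormc wt by rewrite lt_neqAle sqnormc_ge0 andbT eq_sym sqnormc_eq0 ne0.
  have -> : cnorm (x t +i* y t) = sqnormc wt by rewrite cE expr2 cnormM -expr2 sqr_cnorm.
  have -> : x' t ^+ 2 + y' t ^+ 2 = 4 * sqnormc wt * ((a - 8^-1) ^+ 2 + b ^+ 2).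
    by rewrite /x' /y' /sqnormc /wt /=; ring.
  rewrite ler_pdivrMr ?mulr_gt0//.
  have : a ^+ 2 + b ^+ 2 <= (8^-1) ^+ 2.
    have -> : a ^+ 2 + b ^+ 2 = cnorm (a +i* b) ^+ 2 by rewrite sqr_cnorm.
    by rewrite ler_sqr ?nnegrE ?cnorm_ge0// invr_ge0.
  (* As Re w >= 0, |w - 1/8|^2 <= |w|^2 + 1/64 <= 1/32. The squared derivative of the overlap is at
     most 2 |w - 1/8|^2, which leaves a margin below 1/4. *)
  move=> ab; have ab2 : (a - 8^-1) ^+ 2 + b ^+ 2 <= 32^-1 by move: ab a0; lra.
  have := ler_wpM2l (ltW nw) ab2; lra.
have := @is_derive_le_lipschitz R f D' 0 1 2^-1 ler01
  (fun t ht => (dD t ht).1) (fun t ht => (dD t ht).2).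
rewrite subr0 mulr1.
have -> : f 1 = overlap (rep ((a +i* b) ^+ 2)).
  by rewrite /f cE /u !mul1r addrC subrK.
have -> : f 0 = 1.
  rewrite /f cE /u !mul0r addr0.
  have -> : (8^-1 +i* 0) ^+ 2 = (8^-2)%:C :> C.
    by rewrite -[8^-1 +i* 0]/(8^-1)%:C -rmorphXn exprVn.
  have n0 : 0 < nrm (rep (8^-2)%:C) by rewrite /nrm sqrtr_gt0 ell2_sqnorm_gt0 rep_neq0.
  have {1}-> : rep (8^-2)%:C = (nrm (rep (8^-2)%:C))%:C *: Z0.
    rewrite Z0E scalerA -rmorphM divff ?scale1r//; exact: lt0r_neq0.
  rewrite overlapZ.
    by rewrite /overlap ipxx Z01 /sqnormc /= expr1n expr0n addr0 divr1.
  by rewrite eq_complex /= eqxx andbT gt_eqF.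
by rewrite ler_norml => /andP[]; lra.
Qed.

End base.
End cone_curve.

(** * Boundedness in the affine chart against blow-up of the derivative *)

Section contradiction.
Variables (R : realType) (I : choiceType).
Local Notation C := R[i].
Local Notation H := (ell2 R I).
Local Notation N := (@ell2_sqnorm R I).

(* The numerator of the Fubini-Study metric does not depend on the lift, up to
   the factor [sqnormc l ^+ 2]. *)
Lemma gram_affine (Z V : H) (l m : C) :
  N (l *: V + m *: Z) * N (l *: Z) - sqnormc (ip (l *: V + m *: Z) (l *: Z)) =
  sqnormc l ^+ 2 * (N V * N Z - sqnormc (ip V Z)).
Proof.
have E : N (l *: V + m *: Z) = sqnormc l * N V + sqnormc m * N Z +
    2 * complex.Re (l * m^*%C * ip V Z).
  rewrite ell2_sqnormD !ell2_sqnormZ; congr (_ + 2 * _).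
  have -> : ell2_re (l *: V) (m *: Z) = complex.Re (ip (l *: V) (m *: Z)) by [].
  by rewrite ipZl ipZr mulrA.
rewrite E ell2_sqnormZ ipDl !ipZl !ipZr ipxx.
clear E; move: (N V) (N Z) (ip V Z) l m => n k [s1 s2] [l1 l2] [m1 m2].
by rewrite /sqnormc /=; ring.
Qed.

(** In the chart <Z, W> = 1 the vector Z - W has squared norm N Z - 1 and the same pairing with V as
    Z. Cauchy-Schwarz with it leaves at least N V in the Gram determinant, hence the upper bound;
    the lower one drops the pairing and uses N Z >= 1. *)
Lemma gram_bounds (Z V W : H) (rho : R) : N W = 1 -> ip Z W = 1 -> ip V W = 0 ->
  N V * N Z - sqnormc (ip V Z) = N Z ^+ 2 * rho -> 0 <= rho ->
  N V <= rho * N Z ^+ 2 /\ rho <= N V.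
Proof.
move=> W1 ZW VW E rho0.
have E1 : N (Z - 1 *: W) = N Z - 1.
  by rewrite ell2_sqnormB_ip ZW W1 /sqnormc /=; ring.
have n1 : 1 <= N Z by rewrite -subr_ge0 -E1 ell2_sqnorm_ge0.
have E2 : ip V Z = ip V (Z - 1 *: W) by rewrite ipBr ipZr VW mulr0 subr0.
have := cauchy_schwarz V (Z - 1 *: W); rewrite -E2 E1 => CS.
split; first by lra.
have S0 := sqnormc_ge0 (ip V Z).
have : N Z * rho <= N V.
  rewrite -(ler_pM2r (x := N Z)); last by lra.
  by move: E; rewrite expr2; lra.
have : rho <= N Z * rho by rewrite ler_peMl.
by lra.
Qed.

Variable Psi : C -> CP R I.
Hypothesis lifts : cone_isometry Psi.

Let b0 : C := (8^-2)%:C.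
Let Z0 : H := (nrm (rep Psi b0))^-1%:C *: rep Psi b0.

Let Z01 : N Z0 = 1.
Proof.
have n0 : 0 < N (rep Psi b0) by rewrite ell2_sqnorm_gt0 rep_neq0.
rewrite /Z0 ell2_sqnormZ /sqnormc /= expr0n addr0 exprVn sqr_nrm mulVf//.
exact: lt0r_neq0.
Qed.

(** One of the two opposite square roots of [b] has nonnegative real part, so the half-disc |w| <=
    1/8 covers the whole punctured disc |b| <= 1/64. *)
Let overlap_ge b : 0 < cnorm b <= 64^-1 -> 2^-1 <= overlap Z0 (rep Psi b).
Proof.
move=> /andP[b_0 br].
have nw : cnorm (sqrtc b) <= 8^-1.
  rewrite -ler_sqr ?nnegrE ?cnorm_ge0// ?invr_ge0//.
  rewrite expr2 -cnormM -expr2 sqr_sqrtc; apply: le_trans br _.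
  by rewrite le_eqVlt; apply/orP; left; apply/eqP; field.
have w0 : sqrtc b != 0 by rewrite sqrtc_eq0 -cnorm_gt0.
have [re|re] := leP 0 (complex.Re (sqrtc b)).
  by rewrite -[b]sqr_sqrtc; apply: (overlap_near_base lifts).
rewrite -[b]sqr_sqrtc -sqrrN; apply: (overlap_near_base lifts) => //.
- by rewrite oppr_eq0.
- by rewrite cnorm_opp.
- by rewrite raddfN oppr_ge0 ltW.
Qed.

(* The multiple of [Z] in the affine chart [<Z, Z0> = 1]. *)
Let hat (Z : H) : H := (ip Z Z0)^-1 *: Z.

Let hatZ c Z : c != 0 -> hat (c *: Z) = hat Z.
Proof.
move=> c0; rewrite /hat ipZl scalerA invfM mulrC mulrA divff// mul1r//.
Qed.

Let hat_rep b Z : sval (Psi b) Z -> Z != 0 -> hat (rep Psi b) = hat Z.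
Proof.
by move=> /repP[c ->]; rewrite scaler_eq0 negb_or => /andP[c0 _]; rewrite hatZ.
Qed.

Let ip_rep_neq0 b : 0 < cnorm b <= 64^-1 -> ip (rep Psi b) Z0 != 0.
Proof.
move=> /overlap_ge; apply: contraTneq => E.
by rewrite /overlap E -ltNge /sqnormc /= expr0n addr0 mul0r invr_gt0.
Qed.

(** The squared norm of the affine representative is the inverse of the overlap. *)
Let hat_le b : 0 < cnorm b <= 64^-1 -> N (hat (rep Psi b)) <= 2.
Proof.
move=> bb; have := overlap_ge bb; have := ip_rep_neq0 bb.
have sV (q : C) : sqnormc q^-1 = (sqnormc q)^-1 by rewrite -!sqr_cnorm cnormV exprVn.
rewrite /overlap /hat ell2_sqnormZ sV => q0.
have s0 : 0 < sqnormc (ip (rep Psi b) Z0) by rewrite -sqr_cnorm exprn_gt0// cnorm_gt0.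
have n0 : 0 < N (rep Psi b) by rewrite ell2_sqnorm_gt0 rep_neq0.
by rewrite ler_pdivlMr// => h; rewrite mulrC ler_pdivrMr//; lra.
Qed.

Let ip_hat b : 0 < cnorm b <= 64^-1 -> ip (hat (rep Psi b)) Z0 = 1.
Proof. by move=> bb; rewrite /hat ipZl mulVf// ip_rep_neq0. Qed.

(** The derivative is needed only after pairing with a fixed vector. The condition on [b] stands
    under the quantifier so that [choice] yields a function on all of C. The upper bound is 2^2 / (8
    |b|), the factor 2 coming from [hat_le]. *)
Let velocity b : exists W : H, 0 < cnorm b < 64^-1 ->
  [/\ forall v, is_derive b (1 : C) (fun z => ip (hat (rep Psi z)) v) (ip W v),
      N W <= 2^-1 / cnorm b & (8 * cnorm b)^-1 <= N W].
Proof.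
have [bb|nb] := boolP (0 < cnorm b < 64^-1); last by exists 0.
have bb' : 0 < cnorm b <= 64^-1 by lra.
have b_neq0 : b != 0 by rewrite -cnorm_gt0; case/andP: bb.
have nb0 : 0 < cnorm b by rewrite cnorm_gt0.
have [G [V [[d d0 Gd] dG E]]] := lifts b_neq0.
have [Gb Gb0] : sval (Psi b) (G b) /\ G b != 0.
  by have [] := Gd 0; rewrite ?cnorm0 ?addr0.
have hG : hat (rep Psi b) = hat (G b) by exact: hat_rep.
have q0 : ip (G b) Z0 != 0.
  have [c Ec] := repP Gb; rewrite Ec ipZl mulf_neq0 ?ip_rep_neq0//.
  by apply: contra Gb0; rewrite Ec => /eqP ->; rewrite scale0r.
set q := ip (G b) Z0 in q0.
(* This is the quotient rule for G / <G, Z0>; the multiple of [G b] makes W orthogonal to [Z0]. *)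
pose W := q^-1 *: V + (- ip V Z0 / q ^+ 2) *: G b; exists W => _.
have EW : N W * N (hat (G b)) - sqnormc (ip W (hat (G b))) =
    N (hat (G b)) ^+ 2 * (8 * cnorm b)^-1.
  by rewrite gram_affine E ell2_sqnormZ exprMn mulrA.
have W0 : ip W Z0 = 0.
  by rewrite /W ipDl !ipZl -/q; field.
have rho0 : 0 <= (8 * cnorm b)^-1 by rewrite invr_ge0 mulr_ge0// ltW.
have hG1 : ip (hat (G b)) Z0 = 1 by rewrite -hG ip_hat.
have [W1 W2] := gram_bounds Z01 hG1 W0 EW rho0.
split => //; last first.
  apply: le_trans W1 _.
  have -> : 2^-1 / cnorm b = (8 * cnorm b)^-1 * 2 ^+ 2.
    by field; rewrite gt_eqF.
  rewrite ler_wpM2l// ler_sqr ?nnegrE ?ell2_sqnorm_ge0// -hG hat_le//.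
move=> v.
have d1 := lift_diff_ip v dG; have d2 := lift_diff_ip Z0 dG.
have d3 := is_deriveM d1 (is_derive_inv (q0 : (fun z => ip (G z) Z0) b != 0) d2).
have -> : ip W v = ip (G b) v *: (- q ^- 2 *: ip V Z0) + q^-1 *: ip V v.
  by rewrite /W ipDl !ipZl /GRing.scale /=; field.
apply: near_eq_is_derive d3.
exists d%:C; first by rewrite /= ltcR.
move=> z /=; rewrite distrC cnormE ltcR => /Gd; rewrite addrC subrK => -[z1 z2].
by rewrite (hat_rep z1 z2) /hat ipZl mulrC.
Qed.

Lemma no_cone_lift : False.
Proof.
have /choice[W WP] := velocity.
have r4 : (64^-1 : R) / 4 = 256^-1 by field.
(* K is 8 M / r divided by |v|, for M = 2 |v| and r = 1/64. *)
have [K KE] : exists K : R, K = 16 * 64 by eexists.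
have K0 : 0 < K by lra.
(* The point [a] chosen next satisfies 1 / (8 a) = 2 K^2, twice the upper bound K^2 to be obtained
   for the squared velocity. *)
have K2 : 0 < K ^+ 2 by rewrite exprn_gt0.
pose a : R := (16 * K ^+ 2)^-1.
have a0 : 0 < a by rewrite invr_gt0 mulr_gt0.
have na : cnorm (a%:C : C) = a by rewrite cnorm_real gtr0_norm.
have a256 : a < 256^-1.
  rewrite ltf_pV2 ?posrE ?mulr_gt0//.
  have : 64 * K <= K ^+ 2 by rewrite expr2 ler_wpM2r ?(ltW K0)//; lra.
  by lra.
have ar : 0 < cnorm (a%:C : C) < 64^-1 / 4 by rewrite na a0 r4.
have ar' : 0 < cnorm (a%:C : C) < 64^-1 by rewrite na; lra.
have [_ _ W1] := WP _ ar'.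
(* Testing the map against its own velocity at [a] turns the derivative there into the real number
   [N v]. *)
pose v := W a%:C.
have v0 := nrm_ge0 v.
have df z (zr : 0 < cnorm z < 64^-1) :
    is_derive z (1 : C) (fun z => ip (hat (rep Psi z)) v) (ip (W z) v).
  by have [+ _ _] := WP z zr; exact.
have fM z : 0 < cnorm z < 64^-1 -> cnorm (ip (hat (rep Psi z)) v) <= 2 * nrm v.
  move=> zr; apply: le_trans (cnorm_ip _ _) _; rewrite ler_wpM2r//.
  rewrite -ler_sqr ?nnegrE ?nrm_ge0// sqr_nrm.
  have : N (hat (rep Psi z)) <= 2 by apply: hat_le; lra.
  by lra.
have fB p : 0 < p -> exists B, forall z, p < cnorm z < 64^-1 -> cnorm (ip (W z) v) <= B.
  move=> p0; exists (Num.sqrt (2^-1 / p) * nrm v) => z /andP[pz zr].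
  apply: le_trans (cnorm_ip _ _) _; rewrite ler_wpM2r// /nrm ler_wsqrtr//.
  have zz : 0 < cnorm z < 64^-1 by lra.
  have [_ W2 _] := WP z zz; apply: le_trans W2 _.
  by rewrite ler_wpM2l ?invr_ge0// lef_pV2 ?posrE//; lra.
have := bounded_punctured_deriv df fM fB ar.
rewrite ipxx /= -/v -sqr_nrm => L.
have L2 : nrm v <= K.
  have [->|vn] := eqVneq (nrm v) 0; first exact: ltW.
  have vp : 0 < nrm v by rewrite lt_neqAle eq_sym vn.
  by rewrite -(ler_pM2r vp) KE; move: L; rewrite invrK expr2; lra.
have L3 : N v <= K ^+ 2 by rewrite -sqr_nrm ler_sqr ?nnegrE// ltW.
have : (8 * a)^-1 <= K ^+ 2 by rewrite na in W1; exact: le_trans W1 L3.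
rewrite leNgt => /negP; apply.
have -> : (8 * a)^-1 = 2 * K ^+ 2 by rewrite /a; field; exact: lt0r_neq0.
by lra.
Qed.

End contradiction.

(** * From the Kepler manifold to the cone *)

Section kepler_not_induced.
Variables (R : realType) (k : nat) (g : metric_field R k.+2) (I : choiceType).
Local Notation C := R[i].
Local Notation H := (ell2 R I).
Local Notation N := (@ell2_sqnorm R I).
Let e0 : 'rV[C]_k.+1 := delta_mx 0 ord0.

Lemma differentiable_lift_diff (F : 'rV[C]_k.+1 -> H) (b : C) (e : 'rV[C]_k.+1) :
  differentiable F (b *: e) ->
  lift_diff (fun z => F (z *: e)) b ('d F (b *: e) e).
Proof.
move=> dF eps eps0.
have : h^-1 *: ((F \o shift (b *: e)) (h *: e) - F (b *: e)) @[h --> (0 : C)^']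
    --> 'd F (b *: e) e.
  rewrite -deriveE//; exact: diff_derivable.
move=> /cvgrPdist_le /(_ eps%:C); rewrite ltcR => /(_ eps0).
rewrite /dnbhs /within /= => /nbhs_cnorm[d d0 H1]; exists d => // h hd.
have [->|h0] := eqVneq h 0.
  by rewrite addr0 subrr scale0r subr0 cnorm0 mulr0 -(scale0r (0 : H)) nrmZ cnorm0 mul0r.
have := H1 h hd; rewrite add0r => /(_ h0).
rewrite nrmE lecR => H2.
have -> : F ((b + h) *: e) - F (b *: e) - h *: 'd F (b *: e) e =
   (- h) *: ('d F (b *: e) e - h^-1 *: ((F \o shift (b *: e)) (h *: e) - F (b *: e))).
  rewrite scalerBr scalerA mulNr divff// scaleN1r opprK /= /shift /= -scalerDl [h + b]addrC.
  by rewrite scaleNr [RHS]addrC.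
by rewrite nrmZ cnorm_opp mulrC ler_wpM2r ?cnorm_ge0.
Qed.

Hypothesis Hg : kahler_metric_with_potential k.+1 (kepler R k.+1) g (@norm_im R k.+2).

Lemma metric_on_cone (b : C) : b != 0 ->
  g (kepler_param (b *: e0)) ('d (@kepler_param R k) (b *: e0) e0)
    ('d (@kepler_param R k) (b *: e0) e0) = (8 * cnorm b)^-1.
Proof.
move=> b0.
have Ub : [set u : 'rV[C]_k.+1 | u 0 ord0 != 0] (b *: e0).
  by rewrite /= !mxE !eqxx mulr1.
have [_ H2] := Hg (kepler_holomorphic_chart R k) Ub.
(* The Kähler form is g(J·, ·), so the first argument [- 'i *: e0] is the one that yields g at the
   pair (e0, e0). *)
have := H2 (- 'i *: e0) (1 *: e0).
rewrite kahler_form_line linearZ scalerA.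
have -> : 'i * - 'i = 1 :> C by rewrite mulrN -expr2 sqr_i opprK.
rewrite !scale1r.
have -> : (fun z : C^o => (@norm_im R k.+2 \o @kepler_param R k) (z *: e0)) =
   (fun z : C^o => cnorm z / 2).
  by apply/funext => z /=; rewrite norm_im_kepler_param.
by rewrite kahler_form_half_norm// => /complexI.
Qed.

Lemma not_induced_by_CP : ~ @induced_by_CP R k.+1 k.+2 I (kepler R k.+1) g.
Proof.
move=> [psi [hol _ pull]].
apply: (@no_cone_lift R I (fun b => psi (kepler_param (b *: e0)))) => b b0.
have Ub : [set u : 'rV[C]_k.+1 | u 0 ord0 != 0] (b *: e0).
  by rewrite /= !mxE !eqxx mulr1.
have HC := kepler_holomorphic_chart R k.
have [j [F [aff dF]]] := hol _ _ _ _ HC _ Ub.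
have dFb := nbhs_singleton dF.
have [_ Fj] := nbhs_singleton aff.
have F0 u : F u j = 1 -> F u != 0.
  move=> F1; apply/eqP => E; have := oner_neq0 C.
  by rewrite -F1 E => /eqP; apply.
exists (fun z => F (z *: e0)), ('d F (b *: e0) e0); split.
- have : \forall z \near b,
      sval (psi (kepler_param (z *: e0))) (F (z *: e0)) /\ F (z *: e0) j = 1.
    have ce : (fun z : C => z *: e0) @ b --> b *: e0 by exact: scalel_continuous.
    exact: (ce _ aff).
  move=> /nbhs_cnorm[d d0 H1]; exists d => // h hd.
  by have [H2 H3] := H1 h hd; split=> //; exact: F0.
- exact: differentiable_lift_diff.
- have := pull _ _ _ _ HC _ Ub _ _ aff e0 e0.
  rewrite metric_on_cone// fubini_studyE ?F0// => E.
  have n0 : N (F (b *: e0)) != 0 by rewrite ell2_sqnorm_eq0 F0.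
  by rewrite -E [RHS]mulrC divfK// expf_neq0.
Qed.

End kepler_not_induced.

Theorem theorem4p4 (R : realType) (n : nat) (g : metric_field R n.+1) :
  (1 <= n)%N ->
  kahler_metric_with_potential n (kepler R n) g (@norm_im R n.+1) ->
  ~ projectively_induced n (kepler R n) g.
Proof.
(* Writing n = k + 1 provides the two coordinates that the isotropic line needs; the finite and
   infinite projective spaces are the same case, as the index type is arbitrary. *)
case: n g => // k g _ Hg [[N]|]; exact: (not_induced_by_CP Hg).
Qed.
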